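(* Let $Q$ be a tree network and suppose $(Q,\alpha)$ satisfies the Leaf Condition. Then, in the continuous patrolling game on $Q$ with attack duration $\alpha$: - every $E$-patrolling strategy is optimal for the Patroller; - the $E$-attack strategy is optimal for the Attacker; - the value of the game is $V=v^*=\alpha/(\mu+\lambda(E))$.
   Context: $Q$ is a tree: a finite connected acyclic network with no nodes of degree two, not a single line segment. Each arc is an open interval of positive length. $\lambda$ is the length measure, $\mu=\lambda(Q)$, and $d$ is the shortest-path metric. A leaf node has degree $1$ and its arc is a leaf arc. Regular points are the interior points of arcs. The game is as follows. The Patroller picks a patrol $S:[0,\infty)\to Q$ with $d(S(t),S(t'))\le|t-t'|$. The Attacker picks $x\in Q$ and a start time $\tau\ge0$. The Patroller wins iff $x\in S([\tau,\tau+\alpha])$. $V$ is the value with mixed strategies. It is assumed that $0<\alpha<2\mu$. Extremity set: for a regular point $x$, $Q\setminus\{x\}$ has two components $Q_1(x),Q_2(x)$. $E=E(Q,\alpha)$ is the set of regular points $x$ with $\min_i\lambda(Q_i(x))<\alpha/2$. Let $E^c=Q\setminus E$. Leaf Condition: $(Q,\alpha)$ satisfies it if $E$ consists exactly of the points on leaf arcs that are within distance $\alpha/2$ of the leaf node of their arc. In that case each connected component $E_j$ of $E$ lies in a leaf arc and its closure contains the leaf node $x_j$ of that arc. $E$-attack strategy (under the Leaf Condition): let $e_j=\lambda(E_j)$ and $M=\max_j e_j$. Then - with probability $\lambda(E^c)/(\mu+\lambda(E))$, attack a point chosen uniformly in $E^c$ at start time $M$; - for each $j$, with probability $2e_j/(\mu+\lambda(E))$,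 attack leaf node $x_j$ at a start time uniform in $[M-e_j,M+e_j]$. $E$-patrolling strategy: the randomized periodic extension $t\mapsto S^E((t+\Delta)\bmod L)$, with $\Delta$ uniform on $[0,L]$, of a closed unit speed path $S^E:[0,L]\to Q$ with $L=2(\mu+\lambda(E))$ that visits every point $x\in Q$ at two times in $[0,L)$ whose distance modulo $L$ is at least $\alpha$. Such paths exist. *)

(* Defs.v *)
From HB Require Import structures.
From mathcomp Require Import all_boot all_order all_algebra.
From mathcomp Require Import all_classical all_reals all_analysis.

Set Implicit Arguments.
Unset Strict Implicit.
Unset Printing Implicit Defensive.

Import Order.TTheory GRing.Theory Num.Theory.
Import numFieldNormedType.Exports.

Local Open Scope classical_set_scope.
Local Open Scope ring_scope.

(* A finite network: a multigraph whose arc a is a copy of the open interval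
   ]0, len a[, with coordinate 0 at the end src a and len a at the end tgt a. *)
Record network (R : realType) := Network {
  node : finType;
  arc : finType;
  src : arc -> node;
  tgt : arc -> node;
  len : arc -> R;
  len_gt0 : forall a, 0 < len a;
  node_gt0 : (0 < #|node|)%N }.

Section Tree.
Context {R : realType} (N : network R).

(* A dart is an arc together with a direction of travel. *)
Definition dart := (arc N * bool)%type.
Definition dart_src (d : dart) : node N := if d.2 then src d.1 else tgt d.1.
Definition dart_tgt (d : dart) : node N := if d.2 then tgt d.1 else src d.1.

Definition adjacent : rel (node N) :=
  fun u v => [exists d : dart, (dart_src d == u) && (dart_tgt d == v)].

(* Closed walks that use no arc twice; loops and pairs of parallel arcs are
   included. *)
Definition circuit (c : seq dart) : bool :=
  cycle (fun d d' => dart_tgt d == dart_src d') c && uniq (map fst c).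

Definition degree (v : node N) : nat :=
  (#|[set a : arc N | src a == v]%SET| + #|[set a : arc N | tgt a == v]%SET|)%N.

Definition is_leaf (v : node N) : bool := degree v == 1%N.

(* Among trees, the line segments without nodes of degree two are those with
   a single arc. *)
Record is_tree : Prop := IsTree {
  tree_connected : forall u v : node N, connect adjacent u v;
  tree_acyclic : forall c, circuit c -> c = [::];
  tree_degree : forall v, degree v <> 2;
  tree_not_segment : #|arc N| <> 1 }.

End Tree.

Section Points.
Context {R : realType} (N : network R).

Definition pt_pred (p : node N + arc N * R) : bool :=
  if p is inr (a, s) then 0 < s < len a else true.

Record pt := Pt { pt_val : node N + arc N * R; _ : pt_pred pt_val }.

HB.instance Definition _ := [isSub for pt_val].
HB.instance Definition _ := [Choice of pt by <:].

Definition node_pt (v : node N) : pt := @Pt (inl v) isT.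

HB.instance Definition _ :=
  isPointed.Build pt (node_pt (enum_val (Ordinal (node_gt0 N)))).

(* The point of the closed arc a at coordinate s (clamped to [0, len a]). *)
Definition arc_pt (a : arc N) (s : R) : pt :=
  if s <= 0 then node_pt (src a)
  else insubd (node_pt (tgt a)) (inr (a, s)).

Definition regular : set pt :=
  [set x | if pt_val x is inr _ then True else False].

Definition open_arc (a : arc N) : set pt := arc_pt a @` `]0, len a[.

(* chain x y l: some route from x to y made of finitely many segments of closed
   arcs has length l. *)
Inductive chain : pt -> pt -> R -> Prop :=
| chain_nil x : chain x x 0
| chain_cons a s t y l : s \in `[0, len a] -> t \in `[0, len a] ->
    chain (arc_pt a t) y l -> chain (arc_pt a s) y (`|s - t| + l).

(* Shortest-path distance; +oo only between points that no route connects. *)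
Definition dist (x y : pt) : \bar R :=
  ereal_inf [set l%:E | l in chain x y].

Lemma chain_cat x y z l m : chain x y l -> chain y z m -> chain x z (l + m).
Proof.
move=> xy; elim: xy m => [w m|a s t w k sa ta _ IH m] wz; first by rewrite add0r.
by rewrite -addrA; apply: chain_cons => //; exact: IH.
Qed.

Lemma chain_sym x y l : chain x y l -> chain y x l.
Proof.
elim=> [w|a s t w k sa ta _ IH]; first exact: chain_nil.
rewrite addrC; apply: (chain_cat IH).
rewrite distrC -[X in chain _ _ X]addr0; apply: chain_cons => //.
exact: chain_nil.
Qed.

Lemma dist_ltP x y (e : R) :
  (dist x y < e%:E)%E <-> exists2 l, chain x y l & l < e.
Proof.
split=> [/ereal_inf_lt[_ [l xyl <-]]|[l xyl le]].
  by rewrite lte_fin => le; exists l.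
apply: (@le_lt_trans _ _ l%:E); last by rewrite lte_fin.
by apply: ereal_inf_lbound; exists l.
Qed.

Definition pt_ball (x : pt) (e : R) : set pt :=
  [set y | (dist x y < e%:E)%E].

Lemma pt_ball_center x e : 0 < e -> pt_ball x e x.
Proof. by move=> e0; apply/dist_ltP; exists 0 => //; exact: chain_nil. Qed.

Lemma pt_ball_sym x y e : pt_ball x e y -> pt_ball y e x.
Proof.
by move=> /dist_ltP[l xyl le]; apply/dist_ltP; exists l => //; exact: chain_sym.
Qed.

Lemma pt_ball_triangle x y z e1 e2 :
  pt_ball x e1 y -> pt_ball y e2 z -> pt_ball x (e1 + e2) z.
Proof.
move=> /dist_ltP[l xyl le] /dist_ltP[m yzm me]; apply/dist_ltP.
by exists (l + m); [exact: chain_cat yzm|exact: ltrD].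
Qed.

Definition pt_ent : set_system (pt * pt) := entourage_ pt_ball.

HB.instance Definition _ := hasNbhs.Build pt (nbhs_ pt_ent).
HB.instance Definition _ := @Nbhs_isPseudoMetric.Build R pt pt_ent erefl
  pt_ball pt_ball_center pt_ball_sym pt_ball_triangle erefl.

End Points.

(* Borel sigma-algebra of the shortest-path topology. *)
HB.instance Definition _ (R : realType) (N : network R) :=
  @isMeasurable.Build (sigma_display (@open (pt N))) (pt N)
    <<s @open (pt N) >> (@sigma_algebra0 _ setT _)
    (@sigma_algebraC _ _) (@sigma_algebra_bigcup _ setT _).

Section Length.
Context {R : realType} (N : network R).

Definition length (X : set (pt N)) : R :=
  \sum_(a : arc N)
    fine (lebesgue_measure (`]0, len a[ `&` arc_pt a @^-1` X)).

Definition extremity (alpha : R) : set (pt N) :=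
  [set x | regular x /\
     exists2 y, y != x & length (connected_component (~` [set x]) y) < alpha / 2].

(* Points on leaf arcs at distance exactly alpha / 2 from the leaf node are
   left out, in accordance with the strict inequality defining the extremity
   set. *)
Definition leaf_condition (alpha : R) : Prop :=
  extremity alpha =
  [set x | exists v a, [/\ is_leaf v, (src a == v) || (tgt a == v),
     open_arc a x & (dist x (node_pt v) < (alpha / 2)%:E)%E]].

(* The connected component of the extremity set whose closure contains the leaf
   node v. *)
Definition extremity_at (alpha : R) (v : node N) : set (pt N) :=
  [set x | extremity alpha x /\
     closure (connected_component (extremity alpha) x) (node_pt v)].

Definition leaf_extent (alpha : R) (v : node N) : R :=
  length (extremity_at alpha v).

Definition max_extent (alpha : R) : R :=
  \big[Num.max/0]_(v : node N | is_leaf v) leaf_extent alpha v.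

Definition augmented_length (alpha : R) : R :=
  length [set: pt N] + length (extremity alpha).

End Length.

Section Game.
Context {R : realType} (N : network R).

Record patrol := Patrol {
  patrol_fun :> {nonneg R} -> pt N;
  patrol_lipschitz : forall t t' : {nonneg R},
    (dist (patrol_fun t) (patrol_fun t') <= `|t%:num - t'%:num|%:E)%E }.

HB.instance Definition _ := gen_eqMixin patrol.
HB.instance Definition _ := gen_choiceMixin patrol.

Lemma const_lipschitz (x : pt N) (t t' : {nonneg R}) :
  (dist x x <= `|t%:num - t'%:num|%:E)%E.
Proof.
apply: (@le_trans _ _ 0%:E); last by rewrite lee_fin.
by apply: ereal_inf_lbound; exists 0 => //; exact: chain_nil.
Qed.

HB.instance Definition _ :=
  isPointed.Build patrol (Patrol (const_lipschitz point)).

Definition patrol_events : set (set patrol) :=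
  [set A | exists t : {nonneg R}, exists2 B : set (pt N), measurable B &
     A = [set S : patrol | B (S t)]].

(* Generated by the evaluations; it is also the Borel sigma-algebra of uniform
   convergence on bounded time intervals. *)
HB.instance Definition _ :=
  @isMeasurable.Build (sigma_display patrol_events) patrol
    <<s patrol_events >> (@sigma_algebra0 _ setT _)
    (@sigma_algebraC _ _) (@sigma_algebra_bigcup _ setT _).

Definition mixed_patrol := probability patrol R.

(* Probability measures on pt N * [0, +oo[, seen as concentrated measures on
   pt N * R. *)
Record mixed_attack := MixedAttack {
  attack_prob :> probability (pt N * R)%type R;
  attack_start_ge0 : attack_prob ([set: pt N] `*` `[0, +oo[) = 1%E }.

Definition patroller_wins (alpha : R) : set (patrol * (pt N * R)) :=
  [set w : patrol * (pt N * R) | exists2 t : {nonneg R},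
     w.2.2 <= t%:num <= w.2.2 + alpha & w.1 t = w.2.1].

Definition payoff (alpha : R) (p : mixed_patrol) (a : mixed_attack) : \bar R :=
  (p \x a)%E (patroller_wins alpha).

Definition patroller_guarantee (alpha : R) (p : mixed_patrol) : \bar R :=
  ereal_inf (range (payoff alpha p)).

Definition attacker_guarantee (alpha : R) (a : mixed_attack) : \bar R :=
  ereal_sup (range (fun p => payoff alpha p a)).

Definition lower_value (alpha : R) : \bar R :=
  ereal_sup (range (patroller_guarantee alpha)).

Definition upper_value (alpha : R) : \bar R :=
  ereal_inf (range (attacker_guarantee alpha)).

Definition game_value (alpha : R) (v : \bar R) : Prop :=
  lower_value alpha = v /\ upper_value alpha = v.

Definition patroller_optimal (alpha : R) (p : mixed_patrol) : Prop :=
  patroller_guarantee alpha p = lower_value alpha.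

Definition attacker_optimal (alpha : R) (a : mixed_attack) : Prop :=
  attacker_guarantee alpha a = upper_value alpha.

End Game.

Section EStrategies.
Context {R : realType} (N : network R).
Variable alpha : R.

Local Notation E := (@extremity R N alpha).
Local Notation e := (@leaf_extent R N alpha).
Local Notation M := (max_extent N alpha).
Local Notation W := (augmented_length N alpha).

(* When E^c is null, its term vanishes because both the weight and, by
   x / 0 = 0, the normalised length do. *)
Definition is_E_attack (a : mixed_attack N) : Prop :=
  forall A : set (pt N * R), measurable A ->
    a A = (length (~` E) / W *
             (length [set x | (~` E) x /\ A (x, M)] / length (~` E)) +
           \sum_(v : node N | is_leaf v)
             2 * e v / W *
             (fine (lebesgue_measure
                [set tau | M - e v <= tau <= M + e v /\ A (node_pt v, tau)])
              / (2 * e v)))%:E.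

Definition E_period : R := 2 * W.

Definition curve_length (S : R -> pt N) (s t : R) : \bar R :=
  ereal_sup [set \sum_(0 <= n < size r)
      dist (S (nth t (s :: r) n)) (S (nth t (s :: r) n.+1))
    | r in itv_partition s t]%E.

Definition cyclic_dist (L t t' : R) : R := Num.min `|t - t'| (L - `|t - t'|).

(* Unit speed: every piece of the path is exactly as long as its duration. Only
   the values of S on [0, E_period] matter. *)
Definition is_E_path (S : R -> pt N) : Prop :=
  [/\ S 0 = S E_period,
      forall s t, 0 <= s -> s <= t -> t <= E_period ->
        curve_length S s t = (t - s)%:E
    & forall x, exists t t',
        [/\ 0 <= t < E_period, 0 <= t' < E_period, S t = x, S t' = x
          & alpha <= cyclic_dist E_period t t']].

Definition modr (t L : R) : R := t - (Num.floor (t / L))%:~R * L.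

Definition is_E_patrolling (S : R -> pt N) (p : mixed_patrol N) : Prop :=
  forall A : set (patrol N), measurable A ->
    p A = (fine (lebesgue_measure
            [set Delta | 0 <= Delta <= E_period /\
               exists2 q : patrol N, A q &
                 forall t : {nonneg R}, q t = S (modr (t%:num + Delta) E_period)])
           / E_period)%:E.

End EStrategies.

(* Main.v *)
Require Import Defs.
From HB Require Import structures.
From mathcomp Require Import all_boot all_order all_algebra.
From mathcomp Require Import all_classical all_reals all_analysis.
From mathcomp Require Import measurable_realfun.
From mathcomp Require Import lra.
Import Defs.
Import Order.TTheory GRing.Theory Num.Theory.
Import numFieldNormedType.Exports.
Set Implicit Arguments.
Unset Strict Implicit.
Unset Printing Implicit Defensive.
Local Open Scope classical_set_scope.
Local Open Scope ring_scope.

(** Let W = mu + lambda(E).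

    Upper bound. Fix a patrol and let M = max_j e_j. The measure of the points of
    E^c it visits during [M, M + alpha] is at most the time it spends there in
    E^c. The leaf x_j is at distance e_j from the rest of the tree outside E_j,
    so each visit to x_j forces time in E_j, and the measure of the start times
    in [M - e_j, M + e_j] that are intercepted at x_j is at most the time spent
    near x_j during [M, M + alpha]. These times add up to at most alpha.

    Lower bound. A loop of period 2W that visits every point at two times at
    cyclic distance at least alpha intercepts, at a uniform phase, any attack
    with probability at least 2 alpha / (2W). To build such a loop, tour the tree
    depth first. Outside E both sides of a point have length at least alpha / 2,
    so its two visits are far enough apart. A leaf arc longer than alpha / 2 is
    prolonged by a swing at its leaf. The leaf arcs of length at most alpha / 2 at
    a node are toured twice, with the tour of one other branch, if there is one,
    in between; both gaps between the two rounds last at least alpha because the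
    arcs of the tree on either side of a point outside E have total length at
    least alpha / 2. *)

(** * Cutting a tree at an arc *)

(** Distances are infima over chains, so they are bounded below by functions that are 1-Lipschitz
    along every arc. In a tree the basic one is [cut a], the projection onto the arc [a] that
    collapses each of the two remaining pieces to an end; [gap d] is the same projection read from
    the target of the dart [d]. It turns a patrol into a real-valued path, which cannot sweep a set
    longer than the time it takes.

    The sets of attacks that a fixed patrol intercepts are handled by outer measure alone.
    Additivity is applied to the zones where the patrol spends its time, and these are measurable.

    The constant W balances the two sides. Before normalisation the attack has mass length(E^c) + 2
    length(E) = W; the tour gives time 2 to each unit of length outside E and time 4 to each unit
    inside, so its period is 2W. A stub of length l thus receives only time 4 l, possibly less than
    alpha: its visits cannot all be made in one stay, whence the two separate rounds. Since the loop
    is periodic, a gap between visits also needs an upper bound, L - alpha, which is why each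
    estimate for one side of a dart is accompanied by one for the other side. *)

Section Graph.
Context {R : realType} (N : network R).
Implicit Types (d e : dart N) (a b : arc N) (u v w : node N).

Definition rev_dart d : dart N := (d.1, ~~ d.2).

Lemma rev_dartK : involutive rev_dart.
Proof. by case=> a []. Qed.

Lemma dart_src_rev d : dart_src (rev_dart d) = dart_tgt d.
Proof. by case: d => a []. Qed.

Lemma dart_tgt_rev d : dart_tgt (rev_dart d) = dart_src d.
Proof. by case: d => a []. Qed.

Lemma dart_eq_or_rev d e : d.1 = e.1 -> d = e \/ d = rev_dart e.
Proof. by case: d e => a [] [b []] /= ->; [left|right|right|left]. Qed.

Definition adj_avoid a : rel (node N) := fun u v =>
  [exists d : dart N, [&& d.1 != a, dart_src d == u & dart_tgt d == v]].

Lemma adj_avoidP a u v :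
  reflect (exists d, [/\ d.1 != a, dart_src d = u & dart_tgt d = v])
          (adj_avoid a u v).
Proof.
apply: (iffP existsP) => -[d]; first by case/and3P=> ? /eqP ? /eqP ?; exists d.
by case=> da <- <-; exists d; rewrite da !eqxx.
Qed.

Lemma adj_avoid_sym a : symmetric (adj_avoid a).
Proof.
suff H : forall u v, adj_avoid a u v -> adj_avoid a v u.
  by move=> u v; apply/idP/idP; apply: H.
move=> u v /adj_avoidP[d [da <- <-]]; apply/adj_avoidP.
by exists (rev_dart d); rewrite dart_src_rev dart_tgt_rev.
Qed.

(* Removing the arc [a] cuts a tree in two; this singles out the piece that
   contains [tgt a]. *)
Definition tside a v : bool := connect (adj_avoid a) (tgt a) v.

(** Comparing with the direction bit lets one test serve both ends: reversing the dart selects the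
    complementary piece. *)
Definition ahead d v : bool := tside d.1 v == d.2.

(** Testing the source is enough, because both ends of any arc other than [d.1] lie in the same
    piece ([tside_arc]). *)
Definition side d : {set arc N} :=
  [set b | (b != d.1) && ahead d (src b)]%SET.

Definition branch d : {set arc N} := (d.1 |: side d)%SET.

Lemma tside_dart a d : d.1 != a -> tside a (dart_src d) = tside a (dart_tgt d).
Proof.
move=> da; have ad : adj_avoid a (dart_src d) (dart_tgt d).
  by apply/adj_avoidP; exists d.
apply/idP/idP => /connect_trans; apply; apply: connect1; first by [].
by rewrite adj_avoid_sym.
Qed.

Lemma tside_arc a b : b != a -> tside a (src b) = tside a (tgt b).
Proof. by move=> ba; apply: (@tside_dart a (b, true)). Qed.

Lemma tside_tgt a : tside a (tgt a).
Proof. exact: connect0. Qed.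

Lemma side_rev d : side (rev_dart d) = (~: branch d)%SET.
Proof.
apply/setP => b; rewrite !inE /ahead /= negb_or.
by case: eqP => //= _; case: (tside _ _); case: d.2.
Qed.

Lemma branchC d : branch d = (~: side (rev_dart d))%SET.
Proof. by rewrite side_rev finset.setCK. Qed.

End Graph.

Section TreeGraph.
Context {R : realType} (N : network R).
Hypothesis NT : is_tree N.
Implicit Types (d e : dart N) (a b : arc N) (u v w : node N).

Local Notation follows := (fun d d' : dart N => dart_tgt d == dart_src d').

(** A repeated arc would repeat a node, so a simple path of nodes lifts to darts with distinct arcs;
    the last clause is the invariant that makes this induction work. The first clause lets the lift
    follow any dart ending at [u], so that a circuit can be closed with it. *)
Lemma dart_path a u p : path (adj_avoid a) u p -> uniq (u :: p) ->
  exists ds : seq (dart N),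
    [/\ forall d, dart_tgt d = u ->
          path follows d ds /\ dart_tgt (last d ds) = last u p,
        uniq (map fst ds),
        a \notin map fst ds
      & forall d, d \in ds -> dart_src d \in u :: p /\ dart_tgt d \in u :: p].
Proof.
elim: p u => [u _ _|v p IH u] /=; first by exists [::]; split.
case/andP => /adj_avoidP[d [da du dv]] pp /andP[up /(IH _ pp)[ds [H1 H2 H3 H4]]].
exists (d :: ds); split => /=.
- move=> d' d'u; have [H5 H6] := H1 _ dv.
  by rewrite d'u du eqxx.
- rewrite H2 andbT; apply/negP => /mapP[d' d'ds dd'].
  have [sd' td'] := H4 _ d'ds.
  case: (dart_eq_or_rev dd') => dE; rewrite dE ?dart_src_rev in du.
    by rewrite -du sd' in up.
  by rewrite -du td' in up.
- by rewrite inE negb_or eq_sym da.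
- move=> d'; rewrite inE => /orP[/eqP->|/H4[]].
    by rewrite du dv !inE !eqxx orbT.
  by rewrite ![_ \in [:: u, v & p]]inE => -> ->; rewrite !orbT.
Qed.

(** Otherwise a simple path from [tgt a] back to [src a] avoiding [a], preceded by [a] itself, would
    be a nonempty circuit. *)
Lemma tside_src a : tside a (src a) = false.
Proof.
apply/negP => /connectP[p pp lp].
have [q pq uq _] := shortenP pp.
move: lp; have [p' pp' up' _] := shortenP pp => lp.
have [ds [H1 H2 H3 H4]] := dart_path pp' up'.
have [H5 H6] := H1 (a, true) erefl.
suff /(tree_acyclic NT) : circuit ((a, true) :: ds) by [].
rewrite /circuit /= rcons_path H5 H6 -lp /= eqxx /=.
by rewrite H3 H2.
Qed.

Lemma ahead_tgt d : ahead d (dart_tgt d).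
Proof. by case: d => a []; rewrite /ahead /= ?tside_tgt ?tside_src. Qed.

Lemma ahead_src d : ahead d (dart_src d) = false.
Proof. by case: d => a []; rewrite /ahead /= ?tside_tgt ?tside_src. Qed.

Lemma dart_src_neq_tgt d : dart_src d != dart_tgt d.
Proof. by apply/eqP => H; move: (ahead_tgt d); rewrite -H ahead_src. Qed.

Lemma ahead_dart d e : e.1 != d.1 -> ahead d (dart_src e) = ahead d (dart_tgt e).
Proof. by move=> ed; rewrite /ahead (tside_dart ed). Qed.

Lemma same_src_arc_inj d e : dart_src d = dart_src e -> d.1 = e.1 -> d = e.
Proof.
move=> s /dart_eq_or_rev[]// dE.
by move: (dart_src_neq_tgt e); rewrite -s dE dart_src_rev eqxx.
Qed.

Lemma adjacent_connect_ind (P : node N -> Prop) u :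
  P u -> (forall d, P (dart_src d) -> P (dart_tgt d)) -> forall v, P v.
Proof.
move=> Pu H v; have /connectP[p pp ->] := tree_connected NT u v.
elim: p u Pu pp => //= w p IH u Pu /andP[/existsP[d /andP[/eqP du /eqP dw]] pp].
by apply: (IH _ _ pp); rewrite -dw; apply: H; rewrite du.
Qed.

Lemma connect_ahead d v : ahead d v -> connect (adj_avoid d.1) (dart_tgt d) v.
Proof.
have H : forall w, connect (adj_avoid d.1) (dart_tgt d) w ||
           connect (adj_avoid d.1) (dart_src d) w.
  apply: (@adjacent_connect_ind _ (dart_tgt d)) => [|e He]; first by rewrite connect0.
  have [ed|ed] := eqVneq e.1 d.1.
    by case: (dart_eq_or_rev ed) => ->; rewrite ?dart_tgt_rev connect0 ?orbT.
  have ee : connect (adj_avoid d.1) (dart_src e) (dart_tgt e).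
    by apply: connect1; apply/adj_avoidP; exists e.
  by case/orP: He => /connect_trans/(_ ee) ->; rewrite ?orbT.
case: d H => a [] H /=; rewrite /ahead /= /tside; first by move/eqP.
by have := H v; case: (connect _ (tgt a) v); rewrite // orbF.
Qed.

Lemma ahead_ind d (P : node N -> Prop) : P (dart_tgt d) ->
  (forall e, e.1 != d.1 -> ahead d (dart_src e) -> ahead d (dart_tgt e) ->
     P (dart_src e) -> P (dart_tgt e)) ->
  forall v, ahead d v -> P v.
Proof.
move=> P0 Ps v /connect_ahead/connectP[p pp ->].
suff : ahead d (last (dart_tgt d) p) /\ P (last (dart_tgt d) p) by case.
elim/last_ind: p pp => [_|p w IH] /=; first by rewrite ahead_tgt.
rewrite rcons_path last_rcons => /andP[/IH[ad Pl] /adj_avoidP[e [ed se te]]].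
rewrite -te -ahead_dart // se ad; split=> //.
by apply: Ps; rewrite // -?ahead_dart ?se.
Qed.

(** A walk that starts at the target of [d] and avoids its arc never meets the common source, hence
    never crosses the arc of [e]. *)
Lemma ahead_disjoint d e : dart_src d = dart_src e -> d != e ->
  forall v, ahead d v -> ~~ ahead e v.
Proof.
move=> de ned; have dae : d.1 != e.1.
  by apply: contra_neq ned => /(same_src_arc_inj de).
apply: ahead_ind => [|f fd fs ft].
  by rewrite -ahead_dart // de ahead_src.
have [fe|fe] := eqVneq f.1 e.1; last by rewrite ahead_dart.
exfalso; case: (dart_eq_or_rev fe) => fE; move: fs ft.
  by rewrite fE -de ahead_src.
by rewrite fE dart_tgt_rev -de ahead_src => _.
Qed.

Lemma in_side d b : (b \in side d) = (b != d.1) && ahead d (src b).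
Proof. by rewrite inE. Qed.

Lemma in_side_tgt d b : (b \in side d) = (b != d.1) && ahead d (tgt b).
Proof.
rewrite in_side; have [//|/= bd] := eqVneq b d.1.
by rewrite -[src b]/(dart_src (b, true)) ahead_dart.
Qed.

Lemma in_branch d b : (b \in branch d) = (b == d.1) || ahead d (src b).
Proof. by rewrite !inE; case: eqP => /=. Qed.

Lemma branch_disjoint d e : dart_src d = dart_src e -> d != e ->
  forall b, b \in branch d -> b \notin branch e.
Proof.
move=> de ned.
have dae : d.1 != e.1 by apply: contra_neq ned => /(same_src_arc_inj de).
have aux (f g : dart N) : dart_src f = dart_src g -> f.1 != g.1 -> f.1 \notin side g.
  case: f => a [] fg nfg; have := ahead_src g; rewrite -fg /dart_src /= => ga.
    by rewrite in_side ga andbF.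
  by rewrite in_side_tgt ga andbF.
move=> b bd; apply/negP; move: bd; rewrite ![_ \in branch _]in_setU1.
case/orP=> [/eqP->|bd].
  by rewrite (negbTE dae) (negbTE (aux _ _ de dae)).
case/orP=> [/eqP be|be].
  by move: (aux e d (esym de)); rewrite eq_sym => /(_ dae); rewrite -be bd.
move: bd be; rewrite !in_side => /andP[_ /(ahead_disjoint de ned)] /negbTE ->.
by rewrite andbF.
Qed.

(** Along any walk from [v] the dart through which [v] was last left stays behind the current node;
    this is the invariant [H]. *)
Lemma branch_cover v b : exists2 d, dart_src d = v & b \in branch d.
Proof.
have [->|vb] := eqVneq v (src b); first by exists (b, true); rewrite // in_branch eqxx.
have H : forall w, w = v \/ exists2 d, dart_src d = v & ahead d w.
  apply: (@adjacent_connect_ind _ v) => [|d]; first by left.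
  have [tv _|tv] := eqVneq (dart_tgt d) v; first by left.
  case=> [sv|[e ev es]]; right; first by exists d; rewrite ?ahead_tgt.
  exists e => //; rewrite -ahead_dart //; apply/negP => /eqP de.
  case: (dart_eq_or_rev de) => dE; first by rewrite dE ahead_src in es.
  by rewrite dE dart_tgt_rev ev eqxx in tv.
case: (H (src b)) => [/esym/eqP|[d dv da]]; first by rewrite (negbTE vb).
by exists d; rewrite // in_branch da orbT.
Qed.

Definition out v : {set dart N} := [set d | dart_src d == v]%SET.

Lemma rev_in_out d : rev_dart d \in out (dart_tgt d).
Proof. by rewrite inE dart_src_rev. Qed.

Lemma branch_sub_side d e : dart_src e = dart_tgt d -> e != rev_dart d ->
  branch e \subset side d.
Proof.
move=> ed ne; rewrite -[d]rev_dartK side_rev; apply/fintype.subsetP => b be.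
by rewrite finset.in_setC; apply: branch_disjoint be; rewrite // dart_src_rev.
Qed.

(** The arc of [e] lies in [side d] but not in [side e]. This is the decreasing quantity in the
    recursion of the tour. *)
Lemma card_side_lt d e : dart_src e = dart_tgt d -> e != rev_dart d ->
  (#|side e| < #|side d|)%N.
Proof.
move=> ed /(branch_sub_side ed) /subset_leq_card; apply: leq_trans.
by rewrite cardsU1 !inE eqxx.
Qed.

Section Sums.
Variable (f : arc N -> R).

Lemma sum_branch d : \sum_(b in branch d) f b = f d.1 + \sum_(b in side d) f b.
Proof. by rewrite big_setU1 // !inE eqxx. Qed.

Lemma sum_out v : \sum_b f b = \sum_(d in out v) \sum_(b in branch d) f b.
Proof.
rewrite (exchange_big_dep xpredT) //=; apply: eq_bigr => b _.
have [d dv bd] := branch_cover v b.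
rewrite (bigD1 d) /=; last by rewrite inE dv eqxx bd.
rewrite big1 ?addr0 // => e /andP[/andP[]]; rewrite inE => /eqP ev be ed.
by have /(_ b be) := branch_disjoint (etrans ev (esym dv)) ed; rewrite bd.
Qed.

Lemma sum_side_rev d :
  \sum_b f b = f d.1 + \sum_(b in side d) f b + \sum_(b in side (rev_dart d)) f b.
Proof.
rewrite -sum_branch side_rev (bigID (mem (branch d))) /=; congr (_ + _).
by apply: eq_bigl => b; rewrite finset.in_setC.
Qed.

Lemma sum_side d : \sum_(b in side d) f b =
  \sum_(e in out (dart_tgt d) | e != rev_dart d) \sum_(b in branch e) f b.
Proof.
have := sum_out (dart_tgt d).
rewrite (sum_side_rev (rev_dart d)) rev_dartK -sum_branch.
rewrite (bigD1 (rev_dart d) (rev_in_out d)) /=.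
by move/addrI.
Qed.

End Sums.

Lemma card_out v : #|out v| = degree v.
Proof.
have -> : out v = ([set (a, true) | a in [set a : arc N | src a == v]] :|:
                  [set (a, false) | a in [set a : arc N | tgt a == v]])%SET.
  apply/setP => -[a b]; rewrite !inE /=; apply/idP/orP.
    by case: b => av; [left|right]; apply/imsetP; exists a; rewrite ?inE.
  by case=> /imsetP[c]; rewrite inE => cv [-> ->].
rewrite cardsU disjoint_setI0 ?cards0 ?subn0.
  by rewrite !card_imset // => a b [].
rewrite -finset.setI_eq0; apply/eqP/setP => d; rewrite !inE.
by apply/negP => /andP[/imsetP[a _ ->] /imsetP[b _ []]].
Qed.

Lemma leaf_out v : is_leaf v -> exists d, out v = [set d]%SET.
Proof. by rewrite /is_leaf -card_out => /cards1P. Qed.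

Lemma leaf_dart_side d : is_leaf (dart_tgt d) -> side d = finset.set0.
Proof.
move=> /leaf_out[e oE]; have := rev_in_out d; rewrite oE inE => /eqP re.
apply/setP => b; rewrite finset.in_set0; apply/negP => bd.
have [f fd bf] := branch_cover (dart_tgt d) b.
have : f \in out (dart_tgt d) by rewrite inE fd.
rewrite oE inE -re => /eqP fE; move: bf; rewrite fE branchC rev_dartK finset.in_setC.
by rewrite bd.
Qed.

Lemma leaf_dart_unique d e : is_leaf (dart_tgt d) -> dart_tgt d = dart_tgt e -> d = e.
Proof.
move=> /leaf_out[f oE] de; apply: (can_inj (@rev_dartK _ N)).
have := rev_in_out d; have := rev_in_out e.
by rewrite -de oE !inE => /eqP -> /eqP ->.
Qed.

(** With leaves at both ends there would be no arc on either side of [d], and the tree would be a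
    line segment. *)
Lemma leaf_src_not_leaf d : is_leaf (dart_tgt d) -> ~~ is_leaf (dart_src d).
Proof.
move=> l1; apply/negP => l2; apply: (tree_not_segment NT).
have : branch d = [set d.1]%SET.
  by rewrite /branch leaf_dart_side // finset.setU0.
rewrite branchC leaf_dart_side ?dart_tgt_rev // finset.setC0.
by move=> /(congr1 (fun A : {set arc N} => #|A|)); rewrite cards1 cardsT.
Qed.

Lemma leaf_dart_exists v : is_leaf v -> exists d, dart_tgt d = v.
Proof.
move=> /leaf_out[d oE]; exists (rev_dart d); rewrite dart_tgt_rev.
by have := set11 d; rewrite -oE inE => /eqP.
Qed.

Lemma node_out v a : exists d, dart_src d = v.
Proof. by have [d dv _] := branch_cover v a; exists d. Qed.

Lemma nonleaf_exists a : exists v, ~~ is_leaf v.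
Proof.
have [l|nl] := boolP (is_leaf (tgt a)); last by exists (tgt a).
by exists (src a); apply: (@leaf_src_not_leaf (a, true)).
Qed.

End TreeGraph.

(** * The shortest-path metric *)

Section Metric.
Context {R : realType} (N : network R).
Implicit Types (a b : arc N) (u v w : node N) (x y z : pt N) (s t l e : R).

Lemma arc_ptl a s : s <= 0 -> arc_pt a s = node_pt (src a).
Proof. by rewrite /arc_pt => ->. Qed.

Lemma arc_ptr a s : len a <= s -> arc_pt a s = node_pt (tgt a).
Proof.
move=> ls; have s0 : 0 < s := lt_le_trans (len_gt0 a) ls.
rewrite /arc_pt leNgt s0 /= /insubd insubF //=.
by rewrite [s < _]ltNge ls andbF.
Qed.

Lemma pt_val_arc_pt a s : 0 < s < len a -> pt_val (arc_pt a s) = inr (a, s).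
Proof.
by move=> sa; rewrite /arc_pt leNgt (andP sa).1 /= (@insubdK _ _ (pt N)).
Qed.

Variant pt_spec : pt N -> Prop :=
| PtNode v : pt_spec (node_pt v)
| PtArc a s of 0 < s < len a : pt_spec (arc_pt a s).

Lemma ptP x : pt_spec x.
Proof.
case xE : (pt_val x) => [v|[a s]].
  by have -> : x = node_pt v by [apply: val_inj]; exact: PtNode.
have sa : 0 < s < len a by have := valP x; rewrite /= xE.
have -> : x = arc_pt a s by apply: val_inj; rewrite /= xE pt_val_arc_pt.
exact: PtArc.
Qed.

(** Makes explicit the truncation done by [arc_pt], since [chain] accepts only coordinates in
    range. *)
Definition clamp a s : R := Num.max 0 (Num.min s (len a)).

Lemma clamp_itv a s : 0 <= clamp a s <= len a.
Proof.
by rewrite le_max lexx /= ge_max ltW ?len_gt0 //= ge_min lexx orbT.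
Qed.

Lemma arc_pt_clamp a s : arc_pt a (clamp a s) = arc_pt a s.
Proof.
rewrite /clamp; have l0 := len_gt0 a; have [sl|ls] := leP s (len a).
  by have [//|s0] := leP 0 s; rewrite !arc_ptl // ltW.
by rewrite max_r ?(ltW l0) // !arc_ptr // ltW.
Qed.

Lemma clamp_lip a s t : `|clamp a s - clamp a t| <= `|s - t|.
Proof.
have l0 := len_gt0 a; rewrite /clamp ler_norml.
have := ler_norm (s - t); have := ler_norm (t - s); rewrite distrC.
move: `|s - t| => n nt ns.
case: (leP s (len a)) => ?; case: (leP t (len a)) => ?;
  rewrite ?(max_r (ltW l0)); case: (leP 0 s) => ?; case: (leP 0 t) => ?; lra.
Qed.

Lemma chain_arc a s t : chain (arc_pt a s) (arc_pt a t) `|clamp a s - clamp a t|.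
Proof.
rewrite -(arc_pt_clamp a s) -(arc_pt_clamp a t) -[X in chain _ _ X]addr0.
by apply: chain_cons; rewrite ?in_itv ?clamp_itv //; exact: chain_nil.
Qed.

Lemma dist_chain x y l : chain x y l -> (dist x y <= l%:E)%E.
Proof. by move=> c; apply: ereal_inf_lbound; exists l. Qed.

Lemma dist_arc a s t : (dist (arc_pt a s) (arc_pt a t) <= `|s - t|%:E)%E.
Proof.
apply: (le_trans (dist_chain (chain_arc a s t))).
by rewrite lee_fin clamp_lip.
Qed.

Lemma dist_le_eps x y e : (forall d, 0 < d -> (dist x y < (e + d)%:E)%E) ->
  (dist x y <= e%:E)%E.
Proof.
move=> H; apply/lee_addgt0Pr => d d0; rewrite -EFinD; exact/ltW/H.
Qed.

Lemma dist_leP x y e :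
  (dist x y <= e%:E)%E <-> forall d, 0 < d -> exists2 l, chain x y l & l < e + d.
Proof.
split=> [H d d0|H].
  by apply/dist_ltP; apply: (le_lt_trans H); rewrite lte_fin ltrDl.
by apply: dist_le_eps => d d0; apply/dist_ltP; exact: H.
Qed.

Lemma dist_sym x y e : (dist x y <= e%:E)%E -> (dist y x <= e%:E)%E.
Proof.
move=> /dist_leP H; apply/dist_leP => d /H[l c ld].
by exists l => //; exact: chain_sym.
Qed.

Lemma dist_trans x y z e1 e2 : (dist x y <= e1%:E)%E -> (dist y z <= e2%:E)%E ->
  (dist x z <= (e1 + e2)%:E)%E.
Proof.
move=> /dist_leP H1 /dist_leP H2; apply/dist_leP => d d0.
have d2 : 0 < d / 2 by rewrite divr_gt0.
have [l1 c1 h1] := H1 _ d2; have [l2 c2 h2] := H2 _ d2.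
exists (l1 + l2); first exact: chain_cat c2.
by lra.
Qed.

Lemma dist_refl x e : 0 <= e -> (dist x x <= e%:E)%E.
Proof.
by move=> e0; apply: (le_trans (dist_chain (chain_nil x))); rewrite lee_fin.
Qed.

Lemma ballE x e y : ball x e y = (dist x y < e%:E)%E :> Prop.
Proof. by []. Qed.

(** A condition on single arcs, easy to check, that passes to chains and hence to [dist]
    ([lip1_dist]). *)
Definition lip1 (f : pt N -> R) := forall a s t, 0 <= s <= len a ->
  0 <= t <= len a -> `|f (arc_pt a s) - f (arc_pt a t)| <= `|s - t|.

Lemma lip1_chain f x y l : lip1 f -> chain x y l -> `|f x - f y| <= l.
Proof.
move=> fL; elim=> [w|a s t w k sa ta _ IH]; first by rewrite subrr normr0.
rewrite -(subrKA (f (arc_pt a t))); apply: (le_trans (ler_normD _ _)).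
by apply: lerD => //; apply: fL; rewrite ?in_itv /= in sa ta.
Qed.

Lemma lip1_dist f x y e : lip1 f -> (dist x y <= e%:E)%E -> `|f x - f y| <= e.
Proof.
move=> fL /dist_leP H; apply/ler_addgt0Pr => d /H[l c ld].
by rewrite (le_trans (lip1_chain fL c)) // ltW.
Qed.

Lemma lip1_continuous f : lip1 f -> continuous f.
Proof.
move=> fL x; apply/(@cvgrPdist_lt _ _ _ (nbhs x) (nbhs_filter x)) => e e0.
apply/nbhs_ballP; exists e => //= y.
rewrite ballE => /dist_ltP[l c le]; exact: (le_lt_trans (lip1_chain fL c)).
Qed.

Definition lipc (f : R -> pt N) := forall s t, (dist (f s) (f t) <= `|s - t|%:E)%E.

Lemma lipc_continuous f : lipc f -> continuous f.
Proof.
move=> fL x; apply/cvg_ballP => e e0; apply/nbhs_ballP; exists e => //= y xy.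
rewrite ballE; apply: (le_lt_trans (fL _ _)); by rewrite lte_fin.
Qed.

Lemma arc_pt_lipc a : lipc (arc_pt a).
Proof. exact: dist_arc. Qed.

Lemma lip1_lipc f g s t : lip1 f -> lipc g -> `|f (g s) - f (g t)| <= `|s - t|.
Proof. by move=> fL gL; apply: (lip1_dist fL). Qed.

Definition interp (g : node N -> R) x : R :=
  match pt_val x with
  | inl v => g v
  | inr (a, s) => g (src a) + s / len a * (g (tgt a) - g (src a))
  end.

Lemma interp_node g v : interp g (node_pt v) = g v.
Proof. by []. Qed.

Lemma interp_arc g a s : 0 <= s <= len a ->
  interp g (arc_pt a s) = g (src a) + s / len a * (g (tgt a) - g (src a)).
Proof.
move=> /andP[]; rewrite le_eqVlt => /predU1P[<- _|s0].
  by rewrite arc_ptl // interp_node mul0r mul0r addr0.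
rewrite le_eqVlt => /predU1P[->|sl].
  have l0 : len a != 0 by rewrite gt_eqF ?len_gt0.
  by rewrite (arc_ptr (lexx _)) interp_node (divff l0) mul1r addrC subrK.
by rewrite /interp pt_val_arc_pt // s0.
Qed.

Lemma interp_lip1 g : (forall a, `|g (tgt a) - g (src a)| <= len a) -> lip1 (interp g).
Proof.
move=> gl a s t sa ta; rewrite !interp_arc // opprD addrACA subrr add0r -mulrBl.
rewrite -mulrBl !normrM -mulrA ler_piMr // normfV (gtr0_norm (len_gt0 a)).
by rewrite mulrC ler_pdivrMr ?len_gt0 // mul1r.
Qed.

(* The default 1 only matters without arcs. *)
Definition min_len : R := \big[Num.min/1]_(a : arc N) len a.

Lemma min_len_gt0 : 0 < min_len.
Proof.
rewrite /min_len; elim/big_ind: _ => [//|x y|a _];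
by rewrite ?lt_min ?len_gt0 // => -> ->.
Qed.

Lemma min_len_le a : min_len <= len a.
Proof. by rewrite /min_len (bigD1 a) //= ge_min lexx. Qed.

(** The height [min_len] keeps the slope on every arc at most 1 while separating [v] from all other
    nodes. *)
Definition node_sep v : pt N -> R := interp (fun u => if u == v then 0 else min_len).

Lemma node_sep_lip1 v : lip1 (node_sep v).
Proof.
apply: interp_lip1 => a; have := min_len_le a; have := min_len_gt0.
by do 2 case: ifP => _; rewrite ?subrr ?sub0r ?subr0 ?normrN ?normr0 ?len_gt0 // => m0;
   rewrite ?gtr0_norm // => _; exact/ltW/len_gt0.
Qed.

Section Tree.
Hypothesis NT : is_tree N.

(** The coordinate of the projection of the tree onto the closed arc [a]. It is 1-Lipschitz because
    every other arc is collapsed to an end of [a]. *)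
Definition cut a : pt N -> R := interp (fun v => if tside a v then len a else 0).

Lemma cut_lip1 a : lip1 (cut a).
Proof.
apply: interp_lip1 => b; have [->|ba] := eqVneq b a.
  by rewrite tside_tgt tside_src // subr0 gtr0_norm ?len_gt0.
by rewrite (tside_arc ba) subrr normr0 ltW ?len_gt0.
Qed.

Lemma cut_arc a s : 0 <= s <= len a -> cut a (arc_pt a s) = s.
Proof.
move=> sa; rewrite /cut interp_arc // tside_tgt tside_src // subr0 add0r.
by rewrite divfK // gt_eqF ?len_gt0.
Qed.

Lemma cut_other a b s : b != a ->
  cut a (arc_pt b s) = if tside a (src b) then len a else 0.
Proof.
move=> ba; rewrite -arc_pt_clamp /cut interp_arc ?clamp_itv //.
by rewrite (tside_arc ba) subrr mulr0 addr0.
Qed.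

Lemma cut_node a v : cut a (node_pt v) = if tside a v then len a else 0.
Proof. by []. Qed.

Lemma cut_between a x : 0 < cut a x < len a -> x = arc_pt a (cut a x).
Proof.
case: (ptP x) => [v|b s sb].
  by rewrite cut_node; case: ifP => _; rewrite ?ltxx ?andbF.
have [ba|ba] := eqVneq b a.
  have sb' : 0 <= s <= len a by rewrite -ba !ltW ?(andP sb).1 ?(andP sb).2.
  by rewrite ba cut_arc.
by rewrite cut_other //; case: ifP => _; rewrite ?ltxx ?andbF.
Qed.

Lemma cut_ge0 a x : 0 <= cut a x <= len a.
Proof.
have l0 := len_gt0 a; case: (ptP x) => [v|b s sb].
  by rewrite cut_node; case: ifP => _; rewrite ?lexx ltW.
have [ba|ba] := eqVneq b a.
  have sb' : 0 <= s <= len a by rewrite -ba !ltW ?(andP sb).1 ?(andP sb).2.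
  by rewrite ba cut_arc.
by rewrite cut_other //; case: ifP => _; rewrite ?lexx ltW.
Qed.

Lemma dist_eq0 x y : (dist x y <= 0%:E)%E -> x = y.
Proof.
have aux a s z : 0 < s < len a -> (dist (arc_pt a s) z <= 0%:E)%E -> arc_pt a s = z.
  move=> sa dz; have [s0 sl] := andP sa; have := lip1_dist (cut_lip1 a) dz.
  rewrite cut_arc ?(ltW s0) ?(ltW sl) // normr_le0 subr_eq0 => /eqP sE.
  by rewrite (@cut_between a z) -sE.
case: (ptP x) => [v|a s sa]; last exact: aux.
case: (ptP y) => [w|a s sa /dist_sym /(aux _ _ _ sa)//].
move=> /(lip1_dist (node_sep_lip1 v)); rewrite /node_sep !interp_node eqxx sub0r normrN.
by case: eqP => [->//|_]; rewrite normr_le0 gt_eqF ?min_len_gt0.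
Qed.

Lemma pt_on_arc a0 x : exists a s, 0 <= s <= len a /\ x = arc_pt a s.
Proof.
case: (ptP x) => [v|a s /andP[s0 sl]]; last by exists a, s; rewrite !ltW.
have [[a []] <-] := node_out NT v a0.
  by exists a, 0; rewrite lexx arc_ptl // ltW ?len_gt0.
by exists a, (len a); rewrite lexx arc_ptr // ltW ?len_gt0.
Qed.

End Tree.
End Metric.

(** * Lebesgue measure as an outer measure on all sets of reals *)

Section Lebesgue.
Context {R : realType}.
Implicit Types (A B : set R) (f : R -> R).

Local Notation leb := (@lebesgue_measure R).

Lemma leb_mono A B : A `<=` B -> (leb A <= leb B)%E.
Proof.
move=> AB; rewrite /lebesgue_measure /lebesgue_stieltjes_measure /measure_extension.
exact: le_mu_ext.
Qed.

Lemma leb_bigcup (F : (set R)^nat) :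
  (leb (\bigcup_n F n) <= \sum_(n <oo) leb (F n))%E.
Proof. exact: (outer_measure_sigma_subadditive (mu_ext (wlength idfun))). Qed.

Lemma leb_setU A B : (leb (A `|` B) <= leb A + leb B)%E.
Proof.
exact: (outer_measureU2 (mu_ext (wlength idfun))).
Qed.

Lemma leb_itv_cc (a b : R) : a <= b -> leb `[a, b] = (b - a)%:E.
Proof.
move=> ab; rewrite lebesgue_measure_itv /= lte_fin.
by case: ltgtP ab => // -> _; rewrite subrr.
Qed.

Lemma leb_diam A (l : R) : 0 <= l ->
  (forall s t, A s -> A t -> `|s - t| <= l) -> (leb A <= l%:E)%E.
Proof.
move=> l0 H; have [->|/set0P[x0 Ax0]] := eqVneq A set0.
  by rewrite measure0 lee_fin.
have ubA : has_ubound A.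
  exists (x0 + l) => x Ax; have := H _ _ Ax Ax0; rewrite ler_norml; lra.
have lbA : has_lbound A.
  exists (x0 - l) => x Ax; have := H _ _ Ax Ax0; rewrite ler_norml; lra.
have AI : A `<=` `[inf A, sup A].
  by move=> x Ax; rewrite /= in_itv /= ge_inf //= ub_le_sup.
apply: (le_trans (leb_mono AI)).
have le1 : inf A <= sup A by rewrite (le_trans (ge_inf lbA Ax0)) // ub_le_sup.
rewrite leb_itv_cc // lee_fin lerBlDr; apply: ge_sup; first by exists x0.
move=> x Ax; rewrite -lerBlDl; apply: lb_le_inf; first by exists x0.
by move=> y Ay; have := H _ _ Ax Ay; rewrite ler_norml; lra.
Qed.

(** The outer measure is an infimum over covers by half-open intervals, and the image of each
    interval has diameter at most its length. *)
Lemma leb_lip_image f A :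
  (forall s t, `|f s - f t| <= `|s - t|) -> (leb (f @` A) <= leb A)%E.
Proof.
move=> fL; rewrite [leb A]/lebesgue_measure /lebesgue_stieltjes_measure
  /measure_extension /mu_ext; apply: le_ereal_inf_tmp => _ [F [mF AF] <-].
apply: (@le_trans _ _ (leb (\bigcup_n (f @` F n)))).
  apply: leb_mono => _ [x /AF[n _ Fx] <-]; by exists n => //; exists x.
apply: (le_trans (leb_bigcup _)); apply: lee_nneseries => // n _.
have [ab _ <-] := mF n; have [abE|abE] := ltP ab.1 ab.2; last first.
  rewrite set_itv_ge ?bnd_simp -?leNgt // image_set0 measure0.
  exact: wlength_ge0.
rewrite /= (@wlength_itv_bnd _ idfun ab.1 ab.2 false false (ltW abE)).
apply: leb_diam; first by rewrite subr_ge0 ltW.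
move=> _ _ [x + <-] [y + <-]; rewrite /= !in_itv /= => /andP[x1 x2] /andP[y1 y2].
by apply: (le_trans (fL _ _)); rewrite ler_norml; lra.
Qed.

End Lebesgue.

(** * Length and the extremity set *)

Section Length.
Context {R : realType} (N : network R).
Implicit Types (d e : dart N) (a b : arc N) (v w : node N) (x y : pt N).
Implicit Types X Y : set (pt N).

Local Notation leb := (@lebesgue_measure R).

Lemma open_pt_measurable X : open X -> measurable X.
Proof. exact: sub_sigma_algebra. Qed.

Lemma lipc_measurable (f : R -> pt N) : lipc f -> measurable_fun setT f.
Proof.
move=> fL; apply: (@measurability _ _ _ _ _ _ (@open (pt N))) => //.
move=> _ [X oX <-]; rewrite setTI; apply: open_measurable.
by move: fL => /lipc_continuous/continuousP; apply.
Qed.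

Lemma lip1_open (f : pt N -> R) (c1 c2 : R) : lip1 f ->
  open [set x | c1 < f x < c2].
Proof.
move=> /lip1_continuous/continuousP fC.
have -> : [set x | c1 < f x < c2] = f @^-1` `]c1, c2[.
  by apply/seteqP; split => x /=; rewrite in_itv.
exact/fC/interval_open.
Qed.

Definition trace X a : set R := `]0, len a[ `&` arc_pt a @^-1` X.

Lemma trace_le X a : (leb (trace X a) <= (len a)%:E)%E.
Proof.
have := leb_mono (@subIsetl _ `]0, len a[ (arc_pt a @^-1` X)).
by rewrite lebesgue_measure_itv /= lte_fin len_gt0 -EFinB subr0.
Qed.

Lemma trace_fin X a : leb (trace X a) \is a fin_num.
Proof. by rewrite ge0_fin_numE // (le_lt_trans (trace_le X a)) ?ltry. Qed.

Lemma fine_trace_mono X Y a : trace X a `<=` trace Y a ->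
  fine (leb (trace X a)) <= fine (leb (trace Y a)).
Proof. by move=> XY; rewrite fine_le ?trace_fin // leb_mono. Qed.

Lemma trace_measurable X a : measurable X -> measurable (trace X a).
Proof.
move=> mX; apply: measurableI => //; rewrite -[X in measurable X]setTI.
exact: (lipc_measurable (@arc_pt_lipc _ N a)).
Qed.

Lemma lengthE X : length X = \sum_(a : arc N) fine (leb (trace X a)).
Proof. by []. Qed.

Lemma length_ge0 X : 0 <= length X.
Proof. by apply: sumr_ge0 => a _; rewrite fine_ge0. Qed.

Lemma traceT a : leb (trace setT a) = (len a)%:E.
Proof.
rewrite /trace preimage_setT setIT lebesgue_measure_itv /= lte_fin len_gt0.
by rewrite -EFinB subr0.
Qed.

Lemma lengthT : length [set: pt N] = \sum_(a : arc N) len a.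
Proof. by rewrite lengthE; apply: eq_bigr => a _; rewrite traceT. Qed.

Lemma traceC X a : measurable X ->
  fine (leb (trace (~` X) a)) = len a - fine (leb (trace X a)).
Proof.
move=> mX; rewrite -[len a]/(fine (len a)%:E) -traceT.
have -> : trace setT a = trace X a `|` trace (~` X) a.
  by rewrite /trace -setIUr preimage_setC setUv preimage_setT.
rewrite measureU.
- by rewrite fineD ?trace_fin // addrC addKr.
- exact: trace_measurable.
- apply: trace_measurable; exact: measurableC.
- by rewrite -subset0 => s [[_ ?] [_]].
Qed.

Lemma lengthC X : measurable X -> length (~` X) = length [set: pt N] - length X.
Proof.
move=> mX; rewrite lengthT !lengthE -sumrB; apply: eq_bigr => a _.
exact: traceC.
Qed.

End Length.

(** * Oriented coordinates on an arc *)

Section Darts.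
Context {R : realType} (N : network R).
Implicit Types (d e : dart N) (a b : arc N) (v w : node N) (x y : pt N).

Definition dart_pt d (s : R) : pt N :=
  if d.2 then arc_pt d.1 s else arc_pt d.1 (len d.1 - s).

Lemma dart_pt_lipc d : lipc (dart_pt d).
Proof.
move=> s t; rewrite /dart_pt; case: d.2; first exact: arc_pt_lipc.
apply: (le_trans (@arc_pt_lipc _ _ _ _ _)); rewrite lee_fin.
by rewrite [len _ - s - _](_ : _ = t - s) ?[`|t - s|]distrC //; lra.
Qed.

Lemma dart_pt0 d s : s <= 0 -> dart_pt d s = node_pt (dart_src d).
Proof.
case: d => a []; rewrite /dart_pt /dart_src /= => s0; first by rewrite arc_ptl.
by rewrite arc_ptr // lerBrDl gerDr.
Qed.

Lemma dart_pt_len d s : len d.1 <= s -> dart_pt d s = node_pt (dart_tgt d).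
Proof.
case: d => a []; rewrite /dart_pt /dart_tgt /= => s0; first by rewrite arc_ptr.
by rewrite arc_ptl // subr_le0.
Qed.

Lemma dart_pt_rev d s : dart_pt (rev_dart d) s = dart_pt d (len d.1 - s).
Proof. by case: d => a []; rewrite /dart_pt //= opprB addrC subrK. Qed.

Lemma dart_pt_arc d s : 0 <= s <= len d.1 ->
  exists2 s', 0 <= s' <= len d.1 & dart_pt d s' = arc_pt d.1 s.
Proof.
case: d => a [] /= s1; first by exists s.
by exists (len a - s); rewrite /dart_pt //= ?subKr //; lra.
Qed.

Hypothesis NT : is_tree N.

(* The distance to the target of [d] on the arc of [d], constant elsewhere. *)
Definition gap d x : R := if d.2 then len d.1 - cut d.1 x else cut d.1 x.

Lemma gap_lip1 d : lip1 (gap d).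
Proof.
move=> a s t sa ta; rewrite /gap; case: d.2; last exact: cut_lip1.
rewrite distrC [_ - (_ - _)](_ : _ = cut d.1 (arc_pt a s) - cut d.1 (arc_pt a t)).
  exact: cut_lip1.
lra.
Qed.

Lemma gap_dart d s : 0 <= s <= len d.1 -> gap d (dart_pt d s) = len d.1 - s.
Proof.
case: d => a [] /= s1; rewrite /gap /dart_pt /= cut_arc //; lra.
Qed.

Lemma gap_rev d x : gap (rev_dart d) x = len d.1 - gap d x.
Proof. by case: d => a []; rewrite /gap /=; lra. Qed.

Lemma gap_other d b s : b != d.1 ->
  gap d (arc_pt b s) = if ahead d (src b) then 0 else len d.1.
Proof.
move=> bd; rewrite /gap cut_other // /ahead; case: d bd => a [] /= bd;
by case: (tside _ _) => /=; rewrite ?subrr ?subr0.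
Qed.

Lemma gap_node d v : gap d (node_pt v) = if ahead d v then 0 else len d.1.
Proof.
rewrite /gap cut_node /ahead; case: d => a [] /=;
by case: (tside _ _) => /=; rewrite ?subrr ?subr0.
Qed.

Lemma gap_between d x : 0 < gap d x < len d.1 ->
  x = dart_pt d (len d.1 - gap d x).
Proof.
rewrite /gap /dart_pt; case: d => a [] /= h; rewrite subKr; apply: cut_between => //.
lra.
Qed.

Lemma gap_itv d x : 0 <= gap d x <= len d.1.
Proof. by rewrite /gap; have := cut_ge0 NT d.1 x; case: d.2; lra. Qed.

End Darts.

(** * The extremity set under the Leaf Condition *)

Section Extremity.
Context {R : realType} (N : network R) (alpha : R).
Hypothesis NT : is_tree N.
Hypothesis alpha_gt0 : 0 < alpha.
Hypothesis LC : leaf_condition N alpha.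
Implicit Types (d e : dart N) (a b : arc N) (v w : node N) (x y : pt N).

Local Notation leb := (@lebesgue_measure R).
Local Notation E := (@extremity R N alpha).

(** This turns out to be the number e_j of a leaf arc ([leaf_extentE]); the minimum is [len a] when
    the arc lies entirely in the extremity set. *)
Definition tip_len a : R := Num.min (len a) (alpha / 2).

Lemma tip_len_gt0 a : 0 < tip_len a.
Proof. by rewrite lt_min len_gt0 divr_gt0. Qed.

(** When the target of [d] is a leaf, this is the component E_j ([component_tip]). Written through
    [gap], it is visibly open. *)
Definition tip d : set (pt N) := [set x | 0 < gap d x < tip_len d.1].

Lemma open_tip d : open (tip d).
Proof. exact/lip1_open/gap_lip1. Qed.

Lemma tip_other d e s : is_leaf (dart_tgt d) -> e.1 != d.1 ->
  gap d (dart_pt e s) = len d.1.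
Proof.
move=> ld ed; have -> : dart_pt e s = arc_pt e.1 (if e.2 then s else len e.1 - s).
  by rewrite /dart_pt; case: e.2.
rewrite gap_other // ifF //; apply: negbTE; apply/negP => h.
have : e.1 \in side d by rewrite inE ed h.
by rewrite leaf_dart_side // finset.in_set0.
Qed.

Lemma tipE d x : tip d x -> x = dart_pt d (len d.1 - gap d x).
Proof.
by rewrite /tip /tip_len /= lt_min => /and3P[g0 gl _]; apply: gap_between; rewrite ?g0.
Qed.

Lemma tip_disjoint d e x : is_leaf (dart_tgt d) -> is_leaf (dart_tgt e) ->
  tip d x -> tip e x -> d = e.
Proof.
move=> ld le td te; have [de|de] := eqVneq e.1 d.1; last first.
  move: td; rewrite (tipE te) /tip /= tip_other // /tip_len lt_min ltxx.
  by rewrite andbF.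
case: (dart_eq_or_rev de) => // eE; exfalso.
by have := leaf_src_not_leaf NT ld; rewrite -dart_tgt_rev -eE le.
Qed.

(** On a leaf arc [gap] is the distance to the leaf: it is a lower bound, being 1-Lipschitz and zero
    at the leaf, and the arc itself realises it. *)
Lemma extremityE : E = [set x | exists2 d, is_leaf (dart_tgt d) & tip d x].
Proof.
rewrite LC; apply/seteqP; split => x /=.
  move=> [v [a [lv va [s + <-]]]]; rewrite /= in_itv /= => /andP[s0 sl].
  move=> /dist_ltP[l c la].
  have [d dv da] : exists2 d, dart_tgt d = v & d.1 = a.
    by case/orP: va => /eqP va; [exists (a, false)|exists (a, true)].
  exists d; rewrite ?dv // /tip /= /tip_len lt_min da.
  have := lip1_chain (gap_lip1 NT d) c; rewrite -dv gap_node ahead_tgt // subr0.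
  have : 0 < gap d (arc_pt a s) < len a.
    rewrite /gap da cut_arc ?(ltW s0) ?(ltW sl) //; case: d.2; lra.
  by move=> /andP[-> -> /=]; rewrite ler_norml => /andP[_]; lra.
move=> [d ld td]; have xE := tipE td; move: td; rewrite /tip /tip_len /= lt_min.
move=> /and3P[g0 gl ga]; exists (dart_tgt d), d.1; split => //.
- by case: d {ld xE g0 gl ga} => a [] /=; rewrite eqxx ?orbT.
- exists (if d.2 then len d.1 - gap d x else gap d x).
    by rewrite /= in_itv /=; case: d.2; lra.
  by rewrite [RHS]xE /dart_pt; case: d.2; rewrite ?subKr.
- apply: (@le_lt_trans _ _ (gap d x)%:E); last by rewrite lte_fin.
  rewrite [X in dist X _]xE -(@dart_pt_len _ _ d (len d.1)) //.
  apply: (le_trans (@dart_pt_lipc _ _ _ _ _)); rewrite lee_fin.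
  by rewrite addrAC subrr add0r normrN ger0_norm // ltW.
Qed.

Lemma open_extremity : open E.
Proof.
have -> : E = \bigcup_(d in [set d | is_leaf (dart_tgt d)]) tip d.
  by rewrite extremityE; apply/seteqP; split => x [d ? ?]; exists d.
by apply: bigcup_open => d _; exact: open_tip.
Qed.

Definition leafy a := is_leaf (src a) || is_leaf (tgt a).

Definition doubled_len a : R := if leafy a then tip_len a else 0.

Lemma leafyP a : reflect (exists2 d, d.1 = a & is_leaf (dart_tgt d)) (leafy a).
Proof.
apply: (iffP orP) => [[l|l]|[[b []] /= <- l]].
- by exists (a, false).
- by exists (a, true).
- by right.
- by left.
Qed.

Lemma leb_gap d (c : R) : 0 <= c <= len d.1 ->
  leb (trace [set x | 0 < gap d x < c] d.1) = c%:E.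
Proof.
move=> /andP[c0 cl]; have l0 := len_gt0 d.1.
case: d cl l0 => a0 [] /= cl l0.
  have -> : trace [set x | 0 < gap (a0, true) x < c] a0 = `]len a0 - c, len a0[%classic.
    apply/seteqP; split => s; rewrite /trace /= !in_itv /gap /=.
      by move=> [/andP[s0 sl]]; rewrite cut_arc // ?(ltW s0) ?(ltW sl) //; lra.
    move=> s1; have s0 : 0 <= s <= len a0 by lra.
    by rewrite cut_arc //; lra.
  rewrite lebesgue_measure_itv /= lte_fin; case: ifPn => h.
    by rewrite -EFinB opprB addrC subrK.
  by congr EFin; lra.
have -> : trace [set x | 0 < gap (a0, false) x < c] a0 = `]0, c[%classic.
  apply/seteqP; split => s; rewrite /trace /= !in_itv /gap /=.
    by move=> [/andP[s0 sl]]; rewrite cut_arc // ?(ltW s0) ?(ltW sl) //; lra.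
  move=> s1; have s0 : 0 <= s <= len a0 by lra.
  by rewrite cut_arc //; lra.
rewrite lebesgue_measure_itv /= lte_fin; case: ifPn => h.
  by rewrite -EFinB subr0.
by congr EFin; lra.
Qed.

Lemma tip_len_itv a : 0 <= tip_len a <= len a.
Proof. by rewrite ltW ?tip_len_gt0 //= /tip_len ge_min lexx. Qed.

Lemma trace_tip_other d a : is_leaf (dart_tgt d) -> a != d.1 -> trace (tip d) a = set0.
Proof.
move=> ld ad; rewrite -subset0 => s [_] /=.
rewrite -[arc_pt a s]/(dart_pt (a, true) s) /tip /= tip_other //.
by rewrite /tip_len lt_min ltxx andbF.
Qed.

Lemma length_tip d : is_leaf (dart_tgt d) -> length (tip d) = tip_len d.1.
Proof.
move=> ld; rewrite lengthE (bigD1 d.1) //= big1 ?addr0.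
  by rewrite leb_gap // tip_len_itv.
by move=> a ad; rewrite trace_tip_other // measure0.
Qed.

Lemma trace_extremity a : fine (leb (trace E a)) = doubled_len a.
Proof.
rewrite /doubled_len; case: ifPn => [/leafyP[d <- ld]|nl].
  have -> : trace E d.1 = trace (tip d) d.1.
    apply/seteqP; split => s [s0]; rewrite /trace /= extremityE /=.
      move=> [e le te]; split=> //; have [ed|ed] := eqVneq e.1 d.1.
        case: (dart_eq_or_rev ed) => eE; first by move: te; rewrite eE.
        by exfalso; have := leaf_src_not_leaf NT ld; rewrite -dart_tgt_rev -eE le.
      have : trace (tip e) d.1 s by split.
      by rewrite trace_tip_other // eq_sym.
    by move=> td; split=> //; exists d.
  by rewrite leb_gap // tip_len_itv.
suff -> : trace E a = set0 by rewrite measure0.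
rewrite -subset0 => s [s0] /=; rewrite extremityE => -[d ld td].
have : trace (tip d) a s by split.
rewrite trace_tip_other //; apply: contra nl => /eqP ->.
by apply/leafyP; exists d.
Qed.

Lemma length_extremity : length E = \sum_(a : arc N) doubled_len a.
Proof. by rewrite lengthE; apply: eq_bigr => a _; rewrite trace_extremity. Qed.

End Extremity.

Section Extremity2.
Context {R : realType} (N : network R) (alpha : R).
Hypothesis NT : is_tree N.
Hypothesis alpha_gt0 : 0 < alpha.
Hypothesis LC : leaf_condition N alpha.
Implicit Types (d e : dart N) (a b : arc N) (v w : node N) (x y : pt N).

Local Notation leb := (@lebesgue_measure R).
Local Notation E := (@extremity R N alpha).

(** Intermediate values: [gap d] is continuous and vanishes at the target, so to reach a larger
    value the component would have to contain a point of value [len d.1 - s], and the only such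
    point is the one removed. *)
Lemma component_ahead d s : 0 < s < len d.1 ->
  connected_component (~` [set dart_pt d s]) (node_pt (dart_tgt d))
    `<=` [set x | gap d x < len d.1 - s].
Proof.
move=> sl; set C := connected_component _ _ => x Cx /=.
rewrite ltNge; apply/negP => gx.
have gC : connected (gap d @` C).
  apply: connected_continuous_connected; first exact: component_connected.
  exact/continuous_subspaceT/lip1_continuous/gap_lip1.
have C0 : C (node_pt (dart_tgt d)).
  apply: connected_component_refl => /= H.
  have := gap_node d (dart_tgt d); rewrite ahead_tgt // H gap_dart //; lra.
have : (gap d @` C) (len d.1 - s).
  move/connected_intervalP: gC; apply; [exists (node_pt (dart_tgt d))|exists x|] => //.
  by rewrite gx gap_node ahead_tgt // subr_ge0; lra.
move=> [y Cy gy]; have := connected_component_sub Cy; apply.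
by rewrite /= (@gap_between _ _ NT d y) ?gy ?subKr //; lra.
Qed.

Lemma trace_gap_lt d s a : 0 < s < len d.1 ->
  fine (leb (trace [set x | gap d x < len d.1 - s] a)) <=
  if a == d.1 then len d.1 - s else if a \in side d then len a else 0.
Proof.
move=> sl; have [->|ad] := eqVneq a d.1.
  apply: (@le_trans _ _ (fine (leb (trace [set x | 0 < gap d x < len d.1 - s] d.1)))).
    apply: fine_trace_mono => t [t0 /= gt]; split=> //=; rewrite gt andbT.
    move: t0 => /=; rewrite in_itv /= => /andP[t0 tl].
    by rewrite /gap cut_arc ?(ltW t0) ?(ltW tl) //; case: d.2; lra.
  by rewrite leb_gap //; lra.
case: ifPn => [_|nas].
  have := trace_le [set x | gap d x < len d.1 - s] a.
  by rewrite -(fineK (trace_fin _ _)) lee_fin.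
rewrite (_ : trace _ _ = set0) ?measure0 // -subset0 => t [_] /=.
rewrite gap_other // ifF; first lra.
by apply/negbTE; move: nas; rewrite inE ad.
Qed.

(** Turns the topological definition of the extremity set into an inequality between lengths of
    arcs: the component on the target side is no longer than the right-hand side. *)
Lemma not_extremity_ahead d s : 0 < s < len d.1 -> ~ E (dart_pt d s) ->
  alpha / 2 <= len d.1 - s + \sum_(b in side d) len b.
Proof.
move=> sl nE; rewrite leNgt; apply/negP => small; apply: nE; split.
  have s' : 0 < len d.1 - s < len d.1 by lra.
  by rewrite /regular /dart_pt /=; case: d.2; rewrite pt_val_arc_pt.
exists (node_pt (dart_tgt d)).
  apply/eqP => H; have := gap_node d (dart_tgt d).
  rewrite ahead_tgt // H gap_dart //; lra.
apply: le_lt_trans small; rewrite lengthE.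
apply: (@le_trans _ _ (\sum_(a : arc N)
  if a == d.1 then len d.1 - s else if a \in side d then len a else 0)).
  apply: ler_sum => a _; apply: le_trans (trace_gap_lt a sl).
  by apply: fine_trace_mono => t [t0 /(component_ahead sl)].
rewrite (bigD1 d.1) //= eqxx lerD2l [leRHS]big_mkcond /=.
rewrite [leRHS](bigD1 d.1) //= inE eqxx add0r.
by rewrite le_eqVlt; apply/orP; left; apply/eqP/eq_bigr => a /negbTE ->.
Qed.

(** Arcs between two inner nodes count as long whatever their length. The common feature is that,
    towards an end that is not a leaf, points outside the extremity set accumulate. *)
Definition long a := leafy a ==> (alpha / 2 < len a).

(** The only leaf that could bring the point into the extremity set is the source of [d], and it is
    at distance [s]. *)
Lemma not_extremity_dart d s : long d.1 -> ~~ is_leaf (dart_tgt d) ->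
  0 < s < len d.1 -> alpha / 2 <= s -> ~ E (dart_pt d s).
Proof.
move=> lo nl sl as_; rewrite (extremityE NT LC) => -[e le te].
have [ed|ed] := eqVneq e.1 d.1; last first.
  move: te; rewrite /tip /= tip_other // ?(eq_sym d.1) // /tip_len lt_min ltxx.
  by rewrite andbF.
case: (dart_eq_or_rev ed) => eE; first by move: le; rewrite eE (negbTE nl).
move: te; rewrite eE /tip /= gap_rev gap_dart ?(ltW (andP sl).1) ?(ltW (andP sl).2) //.
by rewrite subKr /tip_len lt_min; lra.
Qed.

(* Let a point of the arc outside the extremity set tend to the target of [d]. *)
Lemma long_side d : long d.1 -> ~~ is_leaf (dart_tgt d) ->
  alpha / 2 <= \sum_(b in side d) len b.
Proof.
move=> lo nl; apply/ler_addgt0Pl => eps e0; have l0 := len_gt0 d.1.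
have [lf|nlf] := boolP (leafy d.1).
  have al : alpha / 2 < len d.1 by move: lo; rewrite /long lf.
  (* Close to the target, yet at least alpha / 2 away from the source, which is the leaf here. *)
  pose s := Num.max (len d.1 - eps) (alpha / 2).
  have sl : 0 < s < len d.1 by rewrite lt_max gt_max al divr_gt0 // orbT andbT /=; lra.
  have := not_extremity_ahead sl (not_extremity_dart lo nl sl _).
  rewrite /s le_max lexx orbT => /(_ isT).
  have : len d.1 - eps <= s by rewrite le_max lexx.
  rewrite -/s; lra.
pose s := Num.max (len d.1 - eps) (len d.1 / 2).
have sl : 0 < s < len d.1 by rewrite lt_max gt_max divr_gt0 // orbT /=; lra.
have nE : ~ E (dart_pt d s).
  rewrite (extremityE NT LC) => -[e le te]; have [ed|ed] := eqVneq e.1 d.1.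
    by move/negP: nlf; apply; apply/leafyP; exists e.
  move: te; rewrite /tip /= tip_other // ?(eq_sym d.1) // /tip_len lt_min ltxx.
  by rewrite andbF.
have := not_extremity_ahead sl nE.
have : len d.1 - eps <= s by rewrite le_max lexx.
lra.
Qed.

Lemma tip_sub_extremity d : is_leaf (dart_tgt d) -> tip alpha d `<=` E.
Proof. by move=> ld x td; rewrite (extremityE NT LC) /=; exists d. Qed.

Lemma tip_image d : tip alpha d = dart_pt d @` `]len d.1 - tip_len alpha d.1, len d.1[.
Proof.
have /andP[t0 tl] := tip_len_itv alpha_gt0 d.1.
apply/seteqP; split => x.
  move=> /[dup] /(tipE NT) xE /andP[g0 gt]; exists (len d.1 - gap d x) => //.
  by rewrite /= in_itv /=; lra.
move=> [s]; rewrite /= in_itv /= => /andP[s1 s2] <-.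
by rewrite /tip /= gap_dart //; lra.
Qed.

Lemma tip_connected d : connected (tip alpha d).
Proof.
rewrite tip_image; apply: connected_continuous_connected.
  by apply/connected_intervalP; exact: interval_is_interval.
exact/continuous_subspaceT/lipc_continuous/dart_pt_lipc.
Qed.

(** A tip is connected, and it is clopen in the extremity set because the other tips are open and
    disjoint from it. *)
Lemma component_tip d x : is_leaf (dart_tgt d) -> tip alpha d x ->
  connected_component E x = tip alpha d.
Proof.
move=> ld td; apply/seteqP; split; last first.
  by apply: connected_component_max => //;
    [exact: tip_sub_extremity|exact: tip_connected].
have CE : connected_component E x `<=` E by exact: connected_component_sub.
set C := connected_component E x in CE *.
suff <- : C `&` tip alpha d = C by move=> y [].
apply: (component_connected (A := E) (x := x)).
- exists x; split=> //; apply: connected_component_refl; exact: tip_sub_extremity td.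
- by exists (tip alpha d) => //; exact: open_tip.
- exists (~` (\bigcup_(e in [set e | is_leaf (dart_tgt e) /\ e != d]) tip alpha e)).
    by apply: open_closedC; apply: bigcup_open => e _; exact: open_tip.
  apply/seteqP; split => y [Cy].
    move=> ty; split=> // -[e [le /eqP ed] te]; apply: ed.
    exact: (tip_disjoint NT le ld te ty).
  move=> H; split=> //; have := CE _ Cy; rewrite (extremityE NT LC) => -[e le te].
  have [<-//|ed] := eqVneq e d.
  by exfalso; apply: H; exists e.
Qed.

Lemma extremity_atE d : is_leaf (dart_tgt d) ->
  extremity_at alpha (dart_tgt d) = tip alpha d.
Proof.
move=> ld; apply/seteqP; split => x.
  move=> [/[dup] Ex]; rewrite {1}(extremityE NT LC) => -[e le te].
  rewrite (component_tip le te) => cl.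
  have [<-//|ed] := eqVneq e d; exfalso.
  have ed1 : e.1 != d.1.
    apply/eqP => /dart_eq_or_rev[eE|eE]; first by rewrite eE eqxx in ed.
    by have := leaf_src_not_leaf NT ld; rewrite -dart_tgt_rev -eE le.
  (* On the tip of any other leaf arc [gap d] is constantly [len d.1], so this neighbourhood of the
     leaf misses that tip. *)
  have /cl[y [ty]] : nbhs (node_pt (dart_tgt d)) [set y | gap d y < len d.1].
    have op : open [set y | -1 < gap d y < len d.1] by exact/lip1_open/gap_lip1.
    apply: (@filterS _ _ _ [set y | -1 < gap d y < len d.1]).
      by move=> y /= /andP[].
    apply: open_nbhs_nbhs; split => //=.
    by rewrite gap_node ahead_tgt // len_gt0; lra.
  by rewrite /= (tipE NT ty) tip_other // ltxx.
move=> td; split; first exact: tip_sub_extremity td.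
rewrite (component_tip ld td) => B /nbhs_ballP[eps /= e0 Be].
have t0 := tip_len_gt0 alpha_gt0 d.1; have /andP[_ tl] := tip_len_itv alpha_gt0 d.1.
pose g := Num.min (eps / 2) (tip_len alpha d.1 / 2).
have [g0 ge gt] : [/\ 0 < g, g <= eps / 2 & g <= tip_len alpha d.1 / 2].
  by rewrite /g lt_min !ge_min !lexx orbT; split=> //; apply/andP; split; lra.
exists (dart_pt d (len d.1 - g)); split.
  by rewrite /tip /= gap_dart //; lra.
apply: Be; rewrite ballE -(@dart_pt_len _ _ d (len d.1)) //.
apply: (le_lt_trans (@dart_pt_lipc _ _ _ _ _)); rewrite lte_fin subKr.
rewrite gtr0_norm //; lra.
Qed.

Lemma leaf_extentE d : is_leaf (dart_tgt d) ->
  leaf_extent alpha (dart_tgt d) = tip_len alpha d.1.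
Proof. by move=> ld; rewrite /leaf_extent extremity_atE // length_tip. Qed.

Lemma leaf_extent_itv v : is_leaf v -> 0 < leaf_extent alpha v <= alpha / 2.
Proof.
move=> lv; have [d dv] := leaf_dart_exists lv; rewrite -dv leaf_extentE ?dv //.
by rewrite tip_len_gt0 //= ge_min lexx orbT.
Qed.

Lemma leaf_extent_le_max v : is_leaf v -> leaf_extent alpha v <= max_extent N alpha.
Proof. by move=> lv; rewrite /max_extent (bigD1 v) //= le_max lexx. Qed.

Lemma max_extent_ge0 : 0 <= max_extent N alpha.
Proof.
rewrite /max_extent; elim/big_ind: _ => // [x y|v lv]; first by rewrite le_max => ->.
by have /andP[/ltW] := leaf_extent_itv lv.
Qed.

Lemma sum_leaf_nodes (F : node N -> R) :
  \sum_(v : node N | is_leaf v) F v =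
  \sum_(d : dart N | is_leaf (dart_tgt d)) F (dart_tgt d).
Proof.
rewrite [RHS](partition_big (@dart_tgt _ N) (@is_leaf _ N)) //=.
apply: eq_bigr => v lv; have [d dv] := leaf_dart_exists lv.
rewrite (big_pred1 d) => [|e]; first by rewrite dv.
apply/andP/eqP => [[le /eqP ev]|->]; last by rewrite dv.
by apply: (leaf_dart_unique le); rewrite ev.
Qed.

Lemma sum_leaf_extent :
  \sum_(v : node N | is_leaf v) leaf_extent alpha v = length E.
Proof.
rewrite length_extremity // sum_leaf_nodes.
transitivity (\sum_(d : dart N | is_leaf (dart_tgt d)) tip_len alpha d.1).
  by apply: eq_bigr => d ld; rewrite leaf_extentE.
rewrite big_mkcond /= -(pair_bigA _ (fun (a : arc N) (b : bool) =>
  if is_leaf (dart_tgt (a, b) : node N) then tip_len alpha a else 0)) /=; apply: eq_bigr => a _.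
rewrite big_bool /= /doubled_len /leafy /dart_tgt /=.
have [lt|_] := boolP (is_leaf (tgt a)); last by rewrite add0r orbF.
have := @leaf_src_not_leaf _ _ NT (a, true) lt.
by rewrite /dart_src /= => /negbTE ->; rewrite addr0 orbT.
Qed.

Lemma lengthC_extremity : length (~` E) = length [set: pt N] - length E.
Proof. by rewrite lengthC //; apply: open_pt_measurable; exact: open_extremity. Qed.

End Extremity2.

(** * The payoff *)

Section Wins.
Context {R : realType} (N : network R).
Hypothesis NT : is_tree N.
Implicit Types (x y : pt N) (S : patrol N).

Lemma pos_part_ge0 (r : R) : 0 <= Num.max 0 r.
Proof. by rewrite le_max lexx. Qed.

Definition pos_part (r : R) : {nonneg R} := NngNum (pos_part_ge0 r).

(** The patrol waits at its starting point before time 0, which makes it a 1-Lipschitz curve on the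
    whole line. *)
Definition run S (r : R) : pt N := S (pos_part r).

Lemma run_num S (t : {nonneg R}) : run S t%:num = S t.
Proof. by congr (patrol_fun S _); apply/val_inj => /=; exact: max_r. Qed.

Lemma run_lipc S : lipc (run S).
Proof.
move=> s t; apply: (le_trans (patrol_lipschitz _ _ _)); rewrite lee_fin /=.
have := ler_norm (s - t); have := ler_norm (t - s); rewrite distrC ler_norml.
by case: (leP 0 s) => ?; case: (leP 0 t) => ?; lra.
Qed.

Lemma winsP (alpha : R) S x tau :
  patroller_wins alpha (S, (x, tau)) <->
  exists t : R, [/\ 0 <= t, tau <= t <= tau + alpha & run S t = x].
Proof.
split=> [[t /= tt Sx]|[t [t0 tt Sx]]].
  by exists t%:num; rewrite run_num.
exists (pos_part t); rewrite /= ?max_r //.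
Qed.

Lemma pt_hausdorff : hausdorff_space (pt N).
Proof.
rewrite ball_hausdorff => a b /eqP ab.
have [e e0 nd] : exists2 e, 0 < e & ~ (dist a b <= e%:E)%E.
  apply: contrapT => H; apply: ab; apply: (dist_eq0 NT).
  apply/lee_addgt0Pr => e e0; rewrite add0e.
  by apply: contrapT => nd; apply: H; exists e.
have e2 : 0 < e / 2 by rewrite divr_gt0.
exists (PosNum e2, PosNum e2); apply/eqP; rewrite -subset0 => z [/= az bz].
apply: nd; rewrite [e](splitr e); apply: (@dist_trans _ _ _ z).
  exact/ltW.
by apply: dist_sym; exact/ltW.
Qed.

Lemma open_pt_ball x (e : R) : open (ball x e).
Proof.
rewrite openE => y; rewrite ballE => /dist_ltP[l xy le].
apply/nbhs_ballP; exists (e - l); rewrite /= ?subr_gt0 // => z.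
rewrite !ballE => /dist_ltP[m yz me]; apply/dist_ltP; exists (l + m).
  exact: chain_cat yz.
lra.
Qed.

Definition grid (i : arc N * rat) : pt N := arc_pt i.1 (ratr i.2).

Lemma grid_dense (a0 : arc N) x (e : R) : 0 < e -> exists i, (dist (grid i) x <= e%:E)%E.
Proof.
move=> e0; have [a [s [_ ->]]] := pt_on_arc NT a0 x.
have [q] := @rat_in_itvoo R s (s + e) ltac:(by rewrite ltrDl).
rewrite in_itv /= => /andP[q1 q2]; exists (a, q); rewrite /grid /=.
apply: (le_trans (@arc_pt_lipc _ _ _ _ _)); rewrite lee_fin ger0_norm; lra.
Qed.

(** A measurable box: at a rational time the patrol and the attacked point are both within [e] of
    the same grid point, and the time fits the attack up to [e]. In the patrol and in the last bound
    a negative rational stands for time 0. *)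
Definition wins_approx (alpha e : R) (i : rat * (arc N * rat)) :
    set (patrol N * (pt N * R)) :=
  [set S : patrol N | ball (grid i.2) e (S (pos_part (ratr i.1)))] `*`
  ([set x : pt N | ball (grid i.2) e x] `*` [set tau : R | tau < (ratr i.1 : R) + e /\
    Num.max 0 (ratr i.1 : R) - e - alpha < tau :> R]).

Lemma wins_approx_measurable alpha e i : 0 < e -> measurable (wins_approx alpha e i).
Proof.
move=> e0; have mb : measurable (ball (grid i.2) e : set (pt N)).
  by apply: open_pt_measurable; exact: open_pt_ball.
apply: measurableX.
  apply: sub_sigma_algebra; exists (pos_part (ratr i.1)).
  by exists (ball (grid i.2) e).
apply: measurableX; first exact: mb.
rewrite (_ : [set tau | _] = `]Num.max 0 (ratr i.1) - e - alpha, ratr i.1 + e[%classic).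
  exact: measurable_itv.
apply/seteqP; split => t /=; rewrite in_itv /=; first by case=> -> ->.
by case/andP=> -> ->.
Qed.

(* Compactness of the time window reduces the event to countably many rational
   times and rational points. *)
Lemma wins_approxE (a0 : arc N) (alpha : R) : 0 < alpha ->
  patroller_wins alpha = \bigcap_n \bigcup_i wins_approx alpha n.+1%:R^-1 i.
Proof.
move=> al0; apply/seteqP; split => [[S [x tau]]|[S [x tau]] H].
  move=> /winsP[t [t0 /andP[tt ta] Sx]] n _.
  set e := n.+1%:R^-1; have e0 : 0 < e by rewrite invr_gt0 ltr0n.
  have [i ix] := @grid_dense a0 x (e / 4) ltac:(by rewrite divr_gt0).
  have [q] := @rat_in_itvoo R t (t + e / 4) ltac:(by rewrite ltrDl divr_gt0).
  rewrite in_itv /= => /andP[q1 q2]; exists (q, i) => //; split=> /=; last split.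
  - rewrite ballE -/(run S _); apply: (@le_lt_trans _ _ (e / 4 + e / 4)%:E).
      apply: (dist_trans ix); rewrite -Sx; apply: (le_trans (run_lipc _ _ _)).
      rewrite lee_fin ler_norml; lra.
    rewrite lte_fin; lra.
  - by rewrite ballE; apply: (le_lt_trans ix); rewrite lte_fin; lra.
  - split => /=; first lra.
    rewrite max_r; lra.
apply/winsP; apply: contrapT => nw.
(* An attack that is over before time 0 has an empty window of interception; the bound truncated at
   0 rules it out for small [e]. *)
have [ta0|ta0] := ltP (tau + alpha) 0.
  have /ltr_add_invr[n] : tau + alpha < 0 by [].
  move=> ne; have [i _ [_ [_ [_ h]]]] := H n I; rewrite /= in h.
  have aux (m e' al t : R) : m - e' - al < t -> t + al + e' < 0 -> 0 <= m -> False.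
    by lra.
  exact: aux h ne (pos_part_ge0 _).
pose K := `[Num.max 0 tau, tau + alpha]%classic.
have cK : closed (run S @` K).
  apply: compact_closed; first exact: pt_hausdorff.
  apply: continuous_compact; last exact: segment_compact.
  exact/continuous_subspaceT/lipc_continuous/run_lipc.
have nx : (~` (run S @` K)) x.
  move=> [t]; rewrite /K /= in_itv /= ge_max => /andP[/andP[t0 tt] ta] tx.
  by apply: nw; exists t; rewrite tt ta.
have : nbhs x (~` (run S @` K)).
  by apply: open_nbhs_nbhs; split=> //; exact: closed_openC.
move=> /nbhs_ballP[e /= e0 He].
have [n ne] : exists n : nat, n.+1%:R^-1 < e / 3.
  have := @ltr_add_invr R 0 (e / 3) ltac:(by rewrite divr_gt0).
  by move=> [n]; rewrite add0r; exists n.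
have [i _ [/= ba [/= bx [/= h1 h2]]]] := H n I.
set e' := n.+1%:R^-1 in ne ba bx h1 h2.
have e'0 : 0 < e' by rewrite invr_gt0 ltr0n.
pose q := Num.max 0 (ratr i.1 : R).
(* The nearest point of the window [K] to [q]. *)
pose t := Num.max (Num.max 0 tau) (Num.min q (tau + alpha)).
have Kt : K t.
  by rewrite /K /t /= in_itv /= le_max lexx /= !ge_max ge_min lexx orbT ta0 lerDl ltW.
have qt : `|q - t| <= e'.
  have q0 : 0 <= q by rewrite le_max lexx.
  have qq : ratr i.1 <= q by rewrite le_max lexx orbT.
  rewrite -/q in h2; rewrite /t ler_norml.
  case: (leP q (tau + alpha)) => ?; case: (leP 0 tau) => ?.
  - by case: (leP tau q) => ?; lra.
  - by rewrite max_r //; lra.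
  - by rewrite max_r; lra.
  - by rewrite max_r; lra.
apply: (He (run S t)); last by exists t.
rewrite ballE; apply: (@le_lt_trans _ _ (e' + e' + e')%:E); last by rewrite lte_fin; lra.
apply: (@dist_trans _ _ _ (run S q)); last first.
  by apply: (le_trans (run_lipc _ _ _)); rewrite lee_fin.
apply: (@dist_trans _ _ _ (grid i.2)).
  by apply: dist_sym; exact: ltW.
rewrite /run (_ : pos_part q = pos_part (ratr i.1)); first exact: ltW.
by apply/val_inj => /=; rewrite max_r // le_max lexx.
Qed.

Lemma measurable_wins (a0 : arc N) (alpha : R) : 0 < alpha ->
  measurable (@patroller_wins R N alpha).
Proof.
move=> al0; rewrite (wins_approxE a0 al0); apply: bigcapT_measurable => n.
apply: countable_bigcupT_measurable; first exact: countableP.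
by move=> i; apply: wins_approx_measurable; rewrite invr_gt0 ltr0n.
Qed.

End Wins.

(** * Strategies of the Patroller *)

Section SumMeasure.
Context d (T : measurableType d) (R : realType).

Lemma restricted_image_measure (D : set R) (f : R -> T) :
  measurable D -> measurable_fun [set: R] f ->
  exists m : {measure set T -> \bar R},
    forall A, m A = (@lebesgue_measure R) (D `&` f @^-1` A).
Proof.
move=> mD mf; pose g A := (@lebesgue_measure R) (D `&` f @^-1` A).
have g0 : g set0 = 0%E by rewrite /g preimage_set0 setI0 measure0.
have g_ge0 A : (0 <= g A)%E by exact: measure_ge0.
have g_sigma : semi_sigma_additive g.
  move=> F mF tF mUF; rewrite /g preimage_bigcup setI_bigcupr.
  have mDF n : measurable (D `&` f @^-1` F n).
    by apply: measurableI => //; rewrite -[X in measurable X]setTI; exact: mf.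
  apply: measure_semi_sigma_additive => //; last exact: bigcupT_measurable.
  apply/trivIsetP => i j _ _ ij; rewrite setIACA -(preimage_setI f).
  by have /trivIsetP/(_ i j I I ij) -> := tF; rewrite preimage_set0 setI0.
pose m : {measure set T -> \bar R} :=
  HB.pack g (isMeasure.Build _ _ _ g g0 g_ge0 g_sigma).
by exists m.
Qed.

(** The shape of the E-attack before normalisation, with one summand for each arc and one for each
    node. *)
Lemma sum_image_measure (I : finType) (D : I -> set R) (f : I -> R -> T) :
  (forall i, measurable (D i)) -> (forall i, measurable_fun [set: R] (f i)) ->
  exists m : {measure set T -> \bar R},
    forall A, m A = (\sum_i (@lebesgue_measure R) (D i `&` f i @^-1` A))%E.
Proof.
move=> mD mf; elim: (index_enum I) => [|i s [m mE]].
  exists mzero => A; by rewrite big_nil.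
have [m' m'E] := restricted_image_measure (mD i) (mf i).
exists (measure_add m' m) => A.
by rewrite -[LHS]/(measure_add m' m A) measure_addE m'E mE big_cons.
Qed.

(** The Dirac measure is the default of [mnormalize] for mass zero or infinity, a case excluded by
    [0 < c]. *)
Lemma normalized_probability (m : {measure set T -> \bar R}) (c : R) (x : T) :
  0 < c -> m setT = c%:E ->
  exists p : probability T R, forall A, p A = (m A * (c^-1)%:E)%E.
Proof.
move=> c0 mT; exists (mnormalize m (dirac x)) => A.
by rewrite -[LHS]/(mnormalize m (dirac x) A) /mnormalize mT /= eqe gt_eqF.
Qed.

End SumMeasure.

Section PeriodicMeasure.
Context {R : realType}.
Local Notation leb := (@lebesgue_measure R).

Lemma leb_shift (A : set R) (c : R) : (leb ((+%R c) @` A) <= leb A)%E.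
Proof.
by apply: leb_lip_image => s t; rewrite opprD addrACA subrr add0r.
Qed.

(** The window is cut at the multiple (k + 1) L of the period, and its two pieces are translated
    into [r, L] and [0, r[, which are disjoint. *)
Lemma periodic_leb (B : set R) (L c : R) : measurable B -> 0 < L ->
  (forall (k : int) t, B t -> B (t + k%:~R * L)) ->
  (leb (B `&` `[c, (c + L)%R[) <= leb (B `&` `[0%R, L]))%E.
Proof.
move=> mB L0 per; set k := Num.floor (c / L); pose r := c - k%:~R * L.
have [r0 rL] : 0 <= r /\ r < L.
  have := Num.Theory.floor_itv (c / L); rewrite -/k intrD mulr1z.
  rewrite ler_pdivlMr // ltr_pdivrMr // mulrDl mul1r /r; lra.
have sub : B `&` `[c, c + L[ `<=`
    (+%R (k%:~R * L)) @` (B `&` `[r, L]) `|`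
    (+%R ((k + 1)%:~R * L)) @` (B `&` `[0, r[).
  move=> t [Bt]; rewrite /= in_itv /= => /andP[ct tc].
  have [tL|tL] := leP t (k%:~R * L + L).
    left; exists (t - k%:~R * L); last lra.
    split; last by rewrite /= in_itv /= /r; lra.
    by have := per (- k) _ Bt; rewrite mulrNz mulNr.
  right; exists (t - (k + 1)%:~R * L); last lra.
  rewrite intrD mulr1z mulrDl mul1r; split; last by rewrite /= in_itv /= /r in tc *; lra.
  by have := per (- (k + 1)) _ Bt; rewrite mulrNz intrD mulr1z mulNr mulrDl mul1r.
apply: (le_trans (leb_mono sub)); apply: (le_trans (leb_setU _ _)).
apply: (le_trans (leeD (leb_shift _ _) (leb_shift _ _))).
rewrite -measureU; last 3 first.
- by apply: measurableI => //; exact: measurable_itv.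
- by apply: measurableI => //; exact: measurable_itv.
- by rewrite -subset0 => t [[_ /=]]; rewrite in_itv /= => t1 [_];
   rewrite /= in_itv /=; lra.
apply: leb_mono => t [[Bt]|[Bt]]; rewrite /= in_itv /= => tt; split => //;
  by rewrite /= in_itv /=; lra.
Qed.

End PeriodicMeasure.

Section Modr.
Context {R : realType}.
Variable L : R.
Hypothesis L0 : 0 < L.

Lemma modr_itv (t : R) : 0 <= modr t L < L.
Proof.
have := Num.Theory.floor_itv (t / L); rewrite /modr intrD mulr1z.
rewrite ler_pdivlMr // ltr_pdivrMr // mulrDl mul1r; lra.
Qed.

Lemma modr_shift (k : int) (t : R) : modr (t + k%:~R * L) L = modr t L.
Proof.
rewrite /modr mulrDl mulfK ?gt_eqF // floorDrz ?intrEfloor ?intrKfloor //.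
by rewrite intrD mulrDl; lra.
Qed.

Lemma modr_id (t : R) : 0 <= t < L -> modr t L = t.
Proof.
move=> tL; rewrite /modr (_ : Num.floor _ = 0) ?mul0r ?subr0 //.
by apply: floor_def; rewrite add0r ler_pdivlMr // ltr_pdivrMr // mul0r mul1r.
Qed.

End Modr.

Section Loop.
Context {R : realType} (N : network R).
Hypothesis NT : is_tree N.
Variable (alpha : R).
Hypothesis alpha0 : 0 < alpha.
Local Notation L := (E_period N alpha).
Local Notation W := (augmented_length N alpha).
Hypothesis W0 : 0 < W.
Local Notation leb := (@lebesgue_measure R).

Lemma E_period_gt0 : 0 < L.
Proof. by rewrite /E_period mulr_gt0. Qed.

(** The form in which the lower bound is proved, shared by E-paths and by the tour constructed
    below. *)
Definition covering_loop (S : R -> pt N) : Prop :=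
  [/\ S 0 = S L,
      forall s t : R, 0 <= s -> s <= t -> t <= L -> (dist (S s) (S t) <= (t - s)%:E)%E
    & forall x, exists t t' : R, [/\ 0 <= t < L, 0 <= t' < L, S t = x, S t' = x
          & alpha <= cyclic_dist L t t']].

Lemma E_path_covering_loop S : is_E_path alpha S -> covering_loop S.
Proof.
move=> [S0 SL Scov]; split=> // s t s0 st tL.
have [<-|] := eqVneq s t; first by rewrite subrr; exact: dist_refl.
move=> ne; have lt_st : s < t by rewrite lt_neqAle ne.
rewrite -SL //.
apply: ereal_sup_ubound; exists [:: t]; first by split; rewrite /= ?lt_st.
by rewrite big_nat1.
Qed.

Variable S : R -> pt N.
Hypothesis SL : covering_loop S.

Definition loop (t : R) : pt N := S (modr t L).

Lemma loop_shift (k : int) (t : R) : loop (t + k%:~R * L) = loop t.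
Proof. by rewrite /loop modr_shift // E_period_gt0. Qed.

Lemma loop_lipc : lipc loop.
Proof.
have [S0 Slip _] := SL.
have main s t : s <= t -> (dist (loop s) (loop t) <= (t - s)%:E)%E.
  move=> st; rewrite /loop.
  have /andP[s0 sL] := modr_itv E_period_gt0 s.
  have /andP[t0 tL] := modr_itv E_period_gt0 t.
  have := sL; have := tL; rewrite /modr.
  set ks := Num.floor (s / L); set kt := Num.floor (t / L) => tl sl.
  have kst : ks <= kt by rewrite le_floor // ler_pM2r // invr_gt0 E_period_gt0.
  move: kst; rewrite le_eqVlt => /predU1P[kE|kst].
    have -> : t - s = modr t L - modr s L by rewrite /modr -/ks -/kt kE; lra.
    by apply: Slip; rewrite // ?(ltW tL) // /modr -/ks -/kt kE lerD2r.
  (* The two times lie in different periods, so the path from one to the other passes through the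
     base point [S L = S 0]. *)
  apply: (@le_trans _ _ ((L - modr s L) + (modr t L - 0))%:E).
    apply: (dist_trans (y := S L)); first by apply: Slip; rewrite // ltW.
    by rewrite -S0; apply: Slip; rewrite // ltW.
  rewrite lee_fin /modr -/ks -/kt.
  have : (ks + 1)%:~R * L <= kt%:~R * L.
    by rewrite ler_pM2r ?E_period_gt0 // ler_int lezD1.
  rewrite intrD mulr1z mulrDl mul1r; lra.
move=> s t; have [st|/ltW ts] := leP s t.
  by rewrite distrC ger0_norm ?subr_ge0 //; exact: main.
by rewrite ger0_norm ?subr_ge0 //; apply: dist_sym; exact: main.
Qed.

Lemma loop_patrol_lipschitz (D : R) (t t' : {nonneg R}) :
  (dist (loop (t%:num + D)) (loop (t'%:num + D)) <= `|t%:num - t'%:num|%:E)%E.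
Proof.
apply: (le_trans (loop_lipc _ _)); rewrite lee_fin.
by rewrite opprD addrACA subrr addr0.
Qed.

Definition loop_patrol (D : R) : patrol N := Patrol (loop_patrol_lipschitz D).

Lemma patrol_eq (p q : patrol N) : (forall t, p t = q t) -> p = q.
Proof.
case: p => f fL; case: q => g gL /= /funext fg; subst g.
by congr Patrol; exact: Prop_irrelevance.
Qed.

(** Reads the set of phases in [is_E_patrolling] as a preimage, so that the strategy is the image of
    the uniform measure under [loop_patrol]. *)
Lemma loop_patrolE (A : set (patrol N)) :
  [set Delta | 0 <= Delta <= L /\ exists2 q : patrol N, A q &
     forall t : {nonneg R}, q t = S (modr (t%:num + Delta) L)] =
  `[0, L]%classic `&` loop_patrol @^-1` A.
Proof.
apply/seteqP; split => D /=; rewrite in_itv /=.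
  move=> [DL [q Aq qE]]; split=> //; suff <- : q = loop_patrol D by [].
  exact: patrol_eq.
by move=> [DL AD]; split=> //; exists (loop_patrol D).
Qed.

Lemma loop_patrol_measurable : measurable_fun [set: R] loop_patrol.
Proof.
apply: (@measurability _ _ _ _ _ _ (@patrol_events R N)) => //.
move=> _ [_ [t [B mB ->]] <-]; rewrite setTI.
have lt : lipc (fun D => loop (t%:num + D)).
  move=> s s'; apply: (le_trans (loop_lipc _ _)); rewrite lee_fin.
  by rewrite opprD addrACA subrr add0r.
by have := lipc_measurable lt measurableT mB; rewrite setTI.
Qed.

Lemma E_patrolling_exists : exists p : mixed_patrol N, is_E_patrolling alpha S p.
Proof.
have [m mE] := restricted_image_measure (measurable_itv `[0, L]) loop_patrol_measurable.
have mT : m setT = L%:E.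
  by rewrite mE preimage_setT setIT leb_itv_cc ?subr0 // ltW ?E_period_gt0.
have [p pE] := normalized_probability point E_period_gt0 mT.
exists p => A mA; rewrite loop_patrolE pE mE EFinM fineK //.
rewrite ge0_fin_numE // (le_lt_trans (leb_mono (@subIsetl _ _ _))) //.
by rewrite leb_itv_cc ?ltry // ltW ?E_period_gt0.
Qed.

Lemma wins_loop_patrol (D : R) x (tau : R) :
  patroller_wins alpha (loop_patrol D, (x, tau)) <->
  exists2 t : R, 0 <= t & tau <= t <= tau + alpha /\ loop (t + D) = x.
Proof.
split=> [[t /= tt lx]|[t t0 [tt lx]]]; first by exists t%:num.
by exists (NngNum t0).
Qed.

Lemma E_patrolling_pure (a0 : arc N) p x (tau : R) :
  is_E_patrolling alpha S p -> 0 <= tau ->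
  ((alpha / W)%:E <= p (ysection (patroller_wins alpha) (x, tau)))%E.
Proof.
move=> pE tau0; set A := ysection _ _.
have mA : measurable A by apply: measurable_ysection; exact: measurable_wins.
rewrite pE // loop_patrolE lee_fin.
set B := loop_patrol @^-1` A.
have mB : measurable B.
  by have := loop_patrol_measurable measurableT mA; rewrite setTI.
have BP D : B D <-> exists2 t : R, 0 <= t & tau <= t <= tau + alpha /\ loop (t + D) = x.
  by rewrite /B /A /= ysectionP; exact: wins_loop_patrol.
have L0 := E_period_gt0.
have per (k : int) D : B D -> B (D + k%:~R * L).
  by move=> /BP[t t0 [tt lx]]; apply/BP; exists t => //; rewrite addrA loop_shift.
have fin : leb (`[0, L] `&` B) \is a fin_num.
  rewrite ge0_fin_numE // (le_lt_trans (leb_mono (@subIsetl _ _ _))) //.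
  by rewrite leb_itv_cc ?ltry // ltW.
have al0 := alpha0; suff : ((2 * alpha)%:E <= leb (`[0%R, L] `&` B))%E.
  rewrite -{1}(fineK fin) lee_fin => le2.
  rewrite ler_pdivlMr // (_ : alpha / W * L = 2 * alpha) // /E_period.
  by rewrite mulrCA divfK ?gt_eqF.
have [_ _ /(_ x)[t1 [t2 [h1 h2 S1 S2 dd]]]] := SL.
wlog t12 : t1 t2 h1 h2 S1 S2 dd / t1 <= t2.
  move=> H; have [|/ltW] := leP t1 t2; first exact: (H t1 t2).
  by apply: (H t2 t1) => //; rewrite /cyclic_dist distrC.
move: dd; rewrite /cyclic_dist distrC ger0_norm ?subr_ge0 // le_min => /andP[d1 d2].
(* By periodicity the phases may be taken in a window where the two intervals of
   intercepting phases do not wrap around. *)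
pose c := t1 - alpha - tau.
rewrite setIC; apply: le_trans (periodic_leb c mB L0 per).
(* With phase [D] the point [x] is reached at time [ti - D], which exceeds [tau] and is therefore
   nonnegative. *)
have Bt ti D : 0 <= ti < L -> S ti = x -> ti - alpha - tau < D < ti - tau -> B D.
  move=> hi Si Di; apply/BP; exists (ti - D); first lra.
  by split; [lra|rewrite subrK /loop modr_id].
(* By [d1] the first interval ends before the second begins; by [d2] the second ends before
   [c + L]. *)
have := @leb_mono _ (`]t1 - alpha - tau, t1 - tau[ `|` `]t2 - alpha - tau, t2 - tau[)
  (B `&` `[c, c + L[).
have -> : leb (`]t1 - alpha - tau, t1 - tau[ `|` `]t2 - alpha - tau, t2 - tau[)
    = (2 * alpha)%:E.
  rewrite measureU //=; last first.
    rewrite -subset0 => s [] /=; rewrite !in_itv /= => h3 h4; exfalso; lra.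
  rewrite !lebesgue_measure_itv /= !lte_fin.
  have c1 : t1 - alpha - tau < t1 - tau by lra.
  have c2 : t2 - alpha - tau < t2 - tau by lra.
  rewrite c1 c2.
  by rewrite -!EFinB -EFinD; congr EFin; lra.
apply=> s [] /=; rewrite in_itv /= => hs; split.
- exact: (Bt t1).
- by rewrite /= in_itv /= /c; lra.
- exact: (Bt t2).
- by rewrite /= in_itv /= /c; lra.
Qed.

Lemma E_patrolling_guarantee (a0 : arc N) p : is_E_patrolling alpha S p ->
  ((alpha / W)%:E <= patroller_guarantee alpha p)%E.
Proof.
move=> pE; apply: le_ereal_inf_tmp => _ [a _ <-]; rewrite /payoff.
have mw := measurable_wins NT a0 alpha0.
(* Exchanges the order of integration: the bound is known for each pure attack, so the attack must
   be the outer variable. *)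
have -> : (p \x a)%E (patroller_wins alpha) = (p \x^ a)%E (patroller_wins alpha).
  by apply: product_measure_unique => // A B mA mB; exact: product_measure2E.
rewrite /product_measure2.
have mg := measurable_fun_ysection p mw.
(* The pure bound holds for nonnegative start times, which carry all the mass of the attack. *)
apply: (@le_trans _ _ (\int[a]_(x in [set: pt N] `*` `[0%R, +oo[) (alpha / W)%:E)%E).
  rewrite integral_cst; last by apply: measurableX => //; exact: measurable_itv.
  by rewrite -[X in (X <= _)%E]mule1 le_eqVlt; apply/orP; left; apply/eqP;
    congr (_ * _)%E; exact/esym/attack_start_ge0.
apply: (@le_trans _ _ (\int[a]_(x in [set: pt N] `*` `[0%R, +oo[)
  (p \o ysection (patroller_wins alpha)) x)%E).
  apply: ge0_le_integral => //.
  - by apply: measurableX => //; exact: measurable_itv.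
  - by move=> *; rewrite lee_fin divr_ge0 // ltW.
  - exact: measurable_funTS.
  - move=> [x tau] [_ /=]; rewrite in_itv /= andbT => tau0.
    exact: E_patrolling_pure.
apply: ge0_subset_integral => //.
by apply: measurableX => //; exact: measurable_itv.
Qed.

End Loop.

(** * Strategies of the Attacker *)

Section Coverage.
Context {R : realType}.
Local Notation leb := (@lebesgue_measure R).

Lemma sum_disjoint_leb (I : finType) (A : I -> set R) (B : set R) :
  (forall i, measurable (A i)) -> (forall i j, i != j -> A i `&` A j = set0) ->
  (forall i, A i `<=` B) -> (\sum_i leb (A i) <= leb B)%E.
Proof.
move=> mA dA AB.
suff H (s : seq I) : uniq s -> exists C, [/\ measurable C,
    C = [set t | exists2 i, i \in s & A i t] & (\sum_(i <- s) leb (A i) = leb C)%E].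
  have [C [_ CE ->]] := H _ (index_enum_uniq I).
  by apply: leb_mono => t; rewrite CE => -[i _ /AB].
elim: s => [_|i s IH /= /andP[nis /IH[C [mC CE CS]]]].
  exists set0; split => //; last by rewrite big_nil measure0.
  by apply/esym; rewrite -subset0 => t [].
exists (A i `|` C); split; first exact: measurableU.
  rewrite CE; apply/seteqP; split => t /=.
    case=> [At|[j js At]]; first by exists i; rewrite ?mem_head.
    by exists j; rewrite // inE js orbT.
  by move=> [j]; rewrite inE => /orP[/eqP->|js] At; [left|right; exists j].
rewrite big_cons CS measureU //; first exact: mA.
rewrite -subset0 => t [At]; rewrite CE => -[j js Bt].
have : (A i `&` A j) t by [].
by rewrite dA //; apply: contraNneq nis => ->.
Qed.

Lemma leb_itv_co (a b : R) : a <= b -> leb `[a, b[ = (b - a)%:E.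
Proof.
move=> ab; rewrite lebesgue_measure_itv /= lte_fin.
by case: ltgtP ab => // -> _; rewrite subrr.
Qed.

Lemma leb_itv_oc (a b : R) : a <= b -> leb `]a, b] = (b - a)%:E.
Proof.
move=> ab; rewrite lebesgue_measure_itv /= lte_fin.
by case: ltgtP ab => // -> _; rewrite subrr.
Qed.

(* [K] collects the visits to a leaf and [T] the times of [M, M + alpha] spent
   within [e] of it. A visit in the middle of that window costs time [2 e] and
   intercepts every attack at the leaf; otherwise only the last early visit [s]
   and the first late visit [u] matter. *)
Lemma coverage_le (K T : set R) (M e alpha : R) : 0 < e -> 2 * e <= alpha ->
  (forall t0 t, K t0 -> `|t - t0| < e -> M <= t <= M + alpha -> T t) ->
  (leb [set tau | (M - e <= tau <= M + e)%R /\
          exists t0, K t0 /\ (tau <= t0 <= tau + alpha)%R] <= leb T)%E.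
Proof.
move=> e0 ea KT; set cov := [set tau | _].
have covI : (leb cov <= (2 * e)%:E)%E.
  have cs : cov `<=` `[M - e, M + e] by move=> t [h _] /=; rewrite in_itv.
  by apply: (le_trans (leb_mono cs)); rewrite leb_itv_cc ?lee_fin; lra.
have [[t0 [Kt0 t0M]]|mid] := pselect (exists t0, K t0 /\ M + e <= t0 <= M + alpha - e).
  apply: (le_trans covI).
  have to : `]t0 - e, t0 + e[ `<=` T.
    by move=> t /=; rewrite in_itv /= => h1; apply: (KT t0) => //;
      [rewrite ltr_norml|]; lra.
  apply: le_trans (leb_mono to); rewrite lebesgue_measure_itv /= lte_fin ifT.
    by rewrite -EFinB lee_fin; lra.
  lra.
(* The points [M - e] here and [M + alpha + e] below are defaults for the absence of a visit: they
   keep the sets nonempty, and the associated interval of start times then has measure zero. *)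
pose early := [set t0 | t0 = M - e \/ K t0 /\ M - e <= t0 < M + e].
pose late := [set t0 | t0 = M + alpha + e \/ K t0 /\ M + alpha - e < t0 <= M + alpha + e].
pose s := sup early; pose u := inf late.
have ube : ubound early (M + e) by move=> t [->|[_]]; lra.
have lbl : lbound late (M + alpha - e) by move=> t [->|[_]]; lra.
have sE t : early t -> t <= s by move=> h; apply: ub_le_sup => //; exists (M + e).
have uE t : late t -> u <= t by move=> h; apply: ge_inf => //; exists (M + alpha - e).
have s1 : M - e <= s by apply: sE; left.
have s2 : s <= M + e by apply: ge_sup => //; exists (M - e); left.
have u1 : u <= M + alpha + e by apply: uE; left.
have u2 : M + alpha - e <= u by apply: lb_le_inf => //; exists (M + alpha + e); left.
have Te : `[M, s + e[ `<=` T.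
  move=> t /=; rewrite in_itv /= => /andP[tM ts].
  have te : t - e < s by lra.
  have [t0 [t0E|[Kt0 h]] h'] := sup_gt (ex_intro _ (M - e) (or_introl erefl)) te;
    first lra.
  by apply: (KT t0) => //; [rewrite ltr_norml|]; lra.
have Tl : `]u - e, M + alpha] `<=` T.
  move=> t /=; rewrite in_itv /= => /andP[tu tM].
  have te : u < t + e by lra.
  have [t0 [t0E|[Kt0 h]] h'] :=
    inf_lt (ex_intro _ (M + alpha + e) (or_introl erefl)) te; first lra.
  by apply: (KT t0) => //; [rewrite ltr_norml|]; lra.
have covS : cov `<=` `[M - e, s] `|` `[u - alpha, M + e].
  move=> t [h [t0 [Kt0 h']]]; rewrite /= !in_itv /=.
  have [te|te] := ltP t0 (M + e).
    left; have : t0 <= s by apply: sE; right; split => //; lra.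
    lra.
  have [tl|tl] := leP t0 (M + alpha - e).
    by exfalso; apply: mid; exists t0; split => //; lra.
  right; have : u <= t0 by apply: uE; right; split=> //; lra.
  lra.
(* If the neighbourhoods of the two visits are disjoint, [[M, s + e[] and []u - e, M + alpha]] are
   as long as the two intervals of intercepted start times. Otherwise they fill the window, of
   length alpha >= 2 e. *)
have [su|us] := leP (s + e) (u - e).
  apply: (le_trans (leb_mono covS)); apply: (le_trans (leb_setU _ _)).
  rewrite !leb_itv_cc ?(lerBlDl, lerBlDr); [|lra|lra].
  have TT : `[M, s + e[ `|` `]u - e, M + alpha] `<=` T by move=> t [/Te|/Tl].
  apply: le_trans (leb_mono TT); rewrite measureU //=; last first.
    by rewrite -subset0 => t [] /=; rewrite !in_itv /= => h1 h2; exfalso; lra.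
  by rewrite leb_itv_co ?leb_itv_oc -?EFinD ?lee_fin; lra.
apply: (le_trans covI).
have TT : `[M, M + alpha] `<=` T.
  move=> t /=; rewrite in_itv /= => h; have [ts|ts] := ltP t (s + e).
    by apply: Te; rewrite /= in_itv /=; lra.
  by apply: Tl; rewrite /= in_itv /=; lra.
by apply: le_trans (leb_mono TT); rewrite leb_itv_cc ?lee_fin; lra.
Qed.

End Coverage.

(** * The E-attack against a fixed patrol *)

Section Attack.
Context {R : realType} (N : network R) (alpha : R).
Hypothesis NT : is_tree N.
Hypothesis alpha_gt0 : 0 < alpha.
Hypothesis LC : leaf_condition N alpha.
Variable a0 : arc N.
Implicit Types (d e : dart N) (a b : arc N) (v w : node N) (x y : pt N).

Local Notation leb := (@lebesgue_measure R).
Local Notation E := (@extremity R N alpha).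
Local Notation W := (augmented_length N alpha).
Local Notation M := (max_extent N alpha).
Local Notation ext := (leaf_extent alpha).

Definition arc_zone a : set (pt N) := [set x | 0 < cut a x < len a] `&` ~` E.

(** The tip together with its leaf: the bound -1 is always satisfied and gives the set the open form
    of [lip1_open]. *)
Definition tip_zone d : set (pt N) :=
  if is_leaf (dart_tgt d) then [set x | -1 < gap d x < tip_len alpha d.1] else set0.

Definition zone (i : arc N + dart N) :=
  match i with inl a => arc_zone a | inr d => tip_zone d end.

Lemma zone_measurable i : measurable (zone i).
Proof.
have mE : measurable E by apply: open_pt_measurable; exact: open_extremity.
case: i => [a|d] /=; last first.
  rewrite /tip_zone; case: ifP => // _; apply: open_pt_measurable.
  exact/lip1_open/gap_lip1.
apply: measurableI; last exact: measurableC.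
by apply: open_pt_measurable; apply: lip1_open; exact: cut_lip1.
Qed.

Lemma tip_zone_arc d b (s : R) : 0 <= s <= len b -> tip_zone d (arc_pt b s) ->
  [/\ is_leaf (dart_tgt d) , d.1 = b & gap d (arc_pt b s) < tip_len alpha b].
Proof.
move=> sb; rewrite /tip_zone; case: ifP => // ld /= /andP[_ gt].
have [bd|bd] := eqVneq b d.1; first by rewrite bd in gt *.
move: gt; rewrite -[arc_pt b s]/(dart_pt (b, true) s) tip_other //.
by rewrite /tip_len lt_min ltxx.
Qed.

Lemma zone_disjoint i j : i != j -> zone i `&` zone j = set0.
Proof.
have aa a b : a != b -> arc_zone a `&` arc_zone b = set0.
  move=> ab; rewrite -subset0 => x [[/= xa _] [/= xb _]].
  move: xb; rewrite (@cut_between _ _ NT a x xa) cut_other //.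
  by case: ifP => _; rewrite ltxx ?andbF.
have ad a d : arc_zone a `&` tip_zone d = set0.
  rewrite -subset0 => x [[/= xa nE] xd]; apply: nE.
  have xE := cut_between NT xa; move: xd; rewrite xE => xd.
  have xa' : 0 <= cut a x <= len a by rewrite !ltW ?(andP xa).1 ?(andP xa).2.
  have [ld da gd] := tip_zone_arc xa' xd.
  apply: (tip_sub_extremity NT LC ld); rewrite /tip /= da gd andbT /gap da cut_arc //.
  by case: d.2; lra.
have dd d e : d != e -> tip_zone d `&` tip_zone e = set0.
  move=> de; rewrite -subset0 => x [].
  have [b [s [sb ->]]] := pt_on_arc NT a0 x.
  move=> /(tip_zone_arc sb)[ld db _] /(tip_zone_arc sb)[le eb _].
  case: (dart_eq_or_rev (etrans db (esym eb))) => dE; first by rewrite dE eqxx in de.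
  by have := leaf_src_not_leaf NT le; rewrite -dart_tgt_rev -dE ld.
case: i j => [a|d] [b|e] ij /=; first by apply: aa; apply: contraNneq ij => ->.
- exact: ad.
- by rewrite setIC; exact: ad.
- by apply: dd; apply: contraNneq ij => ->.
Qed.

Section Pure.
Variable S : patrol N.

Definition time_in i : set R := `[M, M + alpha]%classic `&` run S @^-1` zone i.

Lemma time_in_measurable i : measurable (time_in i).
Proof.
apply: measurableI; first exact: measurable_itv.
have := lipc_measurable (@run_lipc _ _ S) measurableT (zone_measurable i).
by rewrite setTI.
Qed.

Lemma sum_time_in : (\sum_i leb (time_in i) <= alpha%:E)%E.
Proof.
have -> : alpha%:E = leb `[M, M + alpha].
  by rewrite leb_itv_cc ?lerDl ?ltW // addrC addKr.
apply: sum_disjoint_leb.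
- exact: time_in_measurable.
- by move=> i j ij; rewrite setIACA -preimage_setI zone_disjoint // preimage_set0 setI0.
- by move=> i t [].
Qed.

(** The visited part of the arc is contained in the image of the time spent in its zone under
    [cut a \o run S], a 1-Lipschitz map. *)
Lemma visited_le a :
  (leb (trace [set x | (~` E) x /\ patroller_wins alpha (S, (x, M))] a)
     <= leb (time_in (inl a)))%E.
Proof.
apply: le_trans (@leb_lip_image _ (cut a \o run S) _ _); last first.
  by move=> s t; exact: (lip1_lipc _ _ (cut_lip1 NT a) (@run_lipc _ _ S)).
apply: leb_mono => s [/=]; rewrite in_itv /= => /andP[s0 sl] [nE /winsP[t [t0 tM St]]].
have sl' : 0 <= s <= len a by rewrite !ltW.
exists t; last by rewrite /= St cut_arc.
split; first by rewrite /= in_itv.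
by rewrite /= St; split=> //=; rewrite cut_arc // s0.
Qed.

(** Within time e_j of a visit to the leaf the value of [gap d] is below e_j, so the patrol is in
    the zone of that leaf. *)
Lemma coverage_tip_le d : is_leaf (dart_tgt d) ->
  (leb [set tau | (M - ext (dart_tgt d) <= tau <= M + ext (dart_tgt d))%R /\
         patroller_wins alpha (S, (node_pt (dart_tgt d), tau))]
     <= leb (time_in (inr d)))%E.
Proof.
move=> ld; have /andP[e0 ea] := leaf_extent_itv NT alpha_gt0 LC ld.
apply: le_trans (@coverage_le _ [set t | run S t = node_pt (dart_tgt d)]
  (time_in (inr d)) M (ext (dart_tgt d)) alpha e0 _ _).
- apply: leb_mono => tau /= [h /winsP[t [t0 tt St]]]; split=> //.
  by exists t.
- lra.
- move=> t1 t /= St1 tt tM; split; first by rewrite /= in_itv.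
  rewrite /= /tip_zone ld /= -(leaf_extentE NT alpha_gt0 LC ld).
  have := lip1_lipc t t1 (gap_lip1 NT d) (@run_lipc _ _ S).
  rewrite St1 gap_node ahead_tgt // => g1.
  have := gap_itv NT d (run S t).
  move: g1 tt; rewrite subr0; move: `|t - t1| => q.
  have := ler_norm (gap d (run S t)); lra.
Qed.

(** The left-hand side is W times the probability that [S] intercepts the E-attack. *)
Lemma attack_pure :
  length [set x | (~` E) x /\ patroller_wins alpha (S, (x, M))] +
  \sum_(v : node N | is_leaf v)
    fine (leb [set tau | M - ext v <= tau <= M + ext v /\
               patroller_wins alpha (S, (node_pt v, tau))]) <= alpha.
Proof.
rewrite lengthE (sum_leaf_nodes (fun v => fine (leb [set tau |
  M - ext v <= tau <= M + ext v /\ patroller_wins alpha (S, (node_pt v, tau))]))).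
have fin i : leb (time_in i) \is a fin_num.
  rewrite ge0_fin_numE // (le_lt_trans (leb_mono (@subIsetl _ _ _))) //.
  by rewrite leb_itv_cc ?ltry // lerDl ltW.
have := sum_time_in; rewrite big_sumType /= => le1.
have le2 : ((\sum_(a : arc N) fine (leb (time_in (inl a))))%:E +
  (\sum_(d : dart N) fine (leb (time_in (inr d))))%:E <= alpha%:E)%E.
  apply: le_trans le1; rewrite -!sumEFin; apply: leeD; apply: lee_sum => i _;
  by rewrite fineK.
move: le2; rewrite -EFinD lee_fin; apply: le_trans; apply: lerD.
  by apply: ler_sum => a _; rewrite fine_le ?trace_fin // visited_le.
rewrite big_mkcond; apply: ler_sum => d _; case: ifPn => [ld|_]; last by rewrite fine_ge0.
have le3 := coverage_tip_le ld; rewrite fine_le //.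
by rewrite ge0_fin_numE // (le_lt_trans le3) // -ge0_fin_numE.
Qed.

End Pure.

Hypothesis W0 : 0 < W.

Lemma E_attack_guarantee (a : mixed_attack N) : is_E_attack alpha a ->
  (attacker_guarantee alpha a <= (alpha / W)%:E)%E.
Proof.
move=> aE; apply: ge_ereal_sup => _ [p _ <-]; rewrite /payoff /product_measure1.
have mw := measurable_wins NT a0 alpha_gt0.
apply: (@le_trans _ _ (\int[p]_(S in [set: patrol N]) (alpha / W)%:E)%E); last first.
  rewrite integral_cst // -[X in (_ <= X)%E]mule1 le_eqVlt; apply/orP; left; apply/eqP.
  by congr (_ * _)%E; exact: probability_setT.
apply: ge0_le_integral => //.
- exact: measurable_fun_xsection.
move=> S _; suff : (a (xsection (patroller_wins alpha) S) <= (alpha / W)%:E)%E by [].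
rewrite aE; last exact: measurable_xsection.
rewrite lee_fin ler_pdivlMr //; apply: le_trans (attack_pure S).
rewrite mulrDl; apply: lerD.
  have -> : [set x | (~` E) x /\ xsection (patroller_wins alpha) S (x, M)] =
      [set x | (~` E) x /\ patroller_wins alpha (S, (x, M))].
    by apply/seteqP; split => x /= [nE /xsectionP].
  have [l0|l0] := eqVneq (length (~` E)) 0.
    by rewrite l0 !mul0r length_ge0.
  by rewrite mulrAC divfK ?gt_eqF // mulrCA mulfV // mulr1.
rewrite mulr_suml; apply: ler_sum => v lv.
have /andP[e0 _] := leaf_extent_itv NT alpha_gt0 LC lv.
have -> : [set tau | M - ext v <= tau <= M + ext v /\
      xsection (patroller_wins alpha) S (node_pt v, tau)] =
    [set tau | M - ext v <= tau <= M + ext v /\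
      patroller_wins alpha (S, (node_pt v, tau))].
  by apply/seteqP; split => x /= [h /xsectionP].
by rewrite mulrAC divfK ?gt_eqF // mulrCA mulfV ?mulr1 // gt_eqF // mulr_gt0.
Qed.

Lemma E_attack_exists : exists a : mixed_attack N, is_E_attack alpha a.
Proof.
have mE : measurable E by apply: open_pt_measurable; exact: open_extremity.
pose D (i : arc N + node N) : set R := match i with
  | inl b => trace (~` E) b
  | inr v => if is_leaf v then `[M - ext v, M + ext v]%classic else set0
  end.
pose f (i : arc N + node N) (t : R) : (pt N * R)%type := match i with
  | inl b => (arc_pt b t, M)
  | inr v => (node_pt v, t)
  end.
have mD i : measurable (D i).
  case: i => [b|v] /=; first by apply: trace_measurable; exact: measurableC.
  by case: ifP => // _; exact: measurable_itv.
have mf i : measurable_fun [set: R] (f i).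
  case: i => [b|v] /=; apply/measurable_fun_pairP; split.
  - apply: lipc_measurable; exact: arc_pt_lipc.
  - exact: measurable_cst.
  - exact: measurable_cst.
  - exact: measurable_id.
have [m mEq] := sum_image_measure mD mf.
have mA (A : set (pt N * R)) : m A =
   (length [set x | (~` E) x /\ A (x, M)] +
    \sum_(v : node N | is_leaf v) fine (leb [set tau |
       M - ext v <= tau <= M + ext v /\ A (node_pt v, tau)]))%:E.
  rewrite mEq big_sumType /= EFinD lengthE -!sumEFin; congr (_ + _)%E.
    apply: eq_bigr => b _; rewrite [RHS]fineK; last exact: trace_fin.
    congr (leb _).
    by apply/seteqP; split => t; rewrite /trace /=; tauto.
  rewrite [RHS]big_mkcond; apply: eq_bigr => v _; case: ifPn => [lv|_]; last first.
    by rewrite set0I measure0.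
  have -> : [set tau | M - ext v <= tau <= M + ext v /\ A (node_pt v, tau)] =
      `[M - ext v, M + ext v]%classic `&` f (inr v) @^-1` A.
    by apply/seteqP; split => t /=; rewrite in_itv /=.
  rewrite fineK // ge0_fin_numE // (le_lt_trans (leb_mono (@subIsetl _ _ _))) //.
  have /andP[e0 _] := leaf_extent_itv NT alpha_gt0 LC lv.
  by rewrite leb_itv_cc ?ltry //; lra.
have leafI v : is_leaf v ->
    leb [set tau | M - ext v <= tau <= M + ext v] = (2 * ext v)%:E.
  move=> lv; have /andP[e0 _] := leaf_extent_itv NT alpha_gt0 LC lv.
  have -> : [set tau | M - ext v <= tau <= M + ext v] = `[M - ext v, M + ext v]%classic.
    by apply/seteqP; split => t /=; rewrite in_itv /=.
  by rewrite leb_itv_cc; [congr EFin|]; lra.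
(* Used twice: for the total mass, and for the mass of the nonnegative start times, which is full
   because e_j <= M. *)
have total (A : set (pt N * R)) : (forall x, A (x, M)) ->
    (forall v (tau : R), is_leaf v -> M - ext v <= tau -> A (node_pt v, tau)) ->
    m A = W%:E.
  move=> A1 A2; rewrite mA; congr EFin.
  have -> : [set x | (~` E) x /\ A (x, M)] = ~` E.
    by apply/seteqP; split => x /=; [case|split].
  rewrite (eq_bigr (fun v => 2 * ext v)); last first.
    move=> v lv.
    have -> : [set tau | M - ext v <= tau <= M + ext v /\ A (node_pt v, tau)] =
        [set tau | M - ext v <= tau <= M + ext v]; last by rewrite leafI.
    apply/seteqP; split => t /=; first by case.
    by move=> /[dup] h /andP[h1 _]; split=> //; exact: A2.
  rewrite -mulr_sumr (sum_leaf_extent NT alpha_gt0 LC) lengthC_extremity //.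
  rewrite /augmented_length; lra.
have mT : m setT = W%:E by apply: total.
have [p pE] := normalized_probability ((point : pt N), (0 : R)) W0 mT.
have p1 : p ([set: pt N] `*` `[0, +oo[) = 1%E.
  rewrite pE total -?EFinM ?divff ?gt_eqF //.
    move=> x; split => //=; rewrite in_itv /= andbT.
    exact: max_extent_ge0.
  move=> v tau lv h; split => //=; rewrite in_itv /= andbT.
  by apply: le_trans h; rewrite subr_ge0; exact: leaf_extent_le_max.
exists (MixedAttack p1) => A mA'; rewrite [LHS]pE mA -EFinM; congr EFin.
rewrite mulrDl; congr (_ + _).
  have [l0|l0] := eqVneq (length (~` E)) 0.
    rewrite l0 !mul0r; apply/eqP; rewrite mulf_eq0; apply/orP; left.
    rewrite eq_le length_ge0 andbT -l0 !lengthE; apply: ler_sum => b _.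
    by apply: fine_trace_mono => t [t0 [nE _]].
  by rewrite [RHS]mulrC -mulrA (mulKf l0).
rewrite mulr_suml; apply: eq_bigr => v lv.
have /andP[e0 _] := leaf_extent_itv NT alpha_gt0 LC lv.
have e2 : 2 * ext v != 0 by rewrite gt_eqF // mulr_gt0.
by rewrite [RHS]mulrC -[RHS]mulrA (mulKf e2).
Qed.

End Attack.

(** * A tour that visits every point twice *)

Section Walks.
Context {R : realType} (N : network R).
Implicit Types (v x : pt N) (f g : R -> pt N) (d : dart N).

Definition glue (c : R) f g (t : R) : pt N := if t <= c then f t else g (t - c).

Lemma glue_lipc c f g : lipc f -> lipc g -> f c = g 0 -> lipc (glue c f g).
Proof.
move=> fL gL fg.
have main s t : s <= t -> (dist (glue c f g s) (glue c f g t) <= (t - s)%:E)%E.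
  move=> st; rewrite /glue; case: (leP s c) => sc; case: (leP t c) => tc.
  - by apply: (le_trans (fL _ _)); rewrite lee_fin distrC ger0_norm ?subr_ge0.
  - rewrite (_ : t - s = (c - s) + (t - c)); last lra.
    apply: (dist_trans (y := f c)).
      by apply: (le_trans (fL _ _)); rewrite lee_fin distrC ger0_norm ?subr_ge0.
    rewrite fg; apply: (le_trans (gL _ _)); rewrite lee_fin sub0r normrN.
    by rewrite ger0_norm // subr_ge0 ltW.
  - by have := lt_le_trans sc (le_trans st tc); rewrite ltxx.
  - apply: (le_trans (gL _ _)); rewrite lee_fin distrC.
    by clear fg; rewrite ger0_norm; lra.
move=> s t; have [st|/ltW ts] := leP s t.
  by rewrite distrC ger0_norm ?subr_ge0 //; exact: main.
by rewrite ger0_norm ?subr_ge0 //; apply: dist_sym; exact: main.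
Qed.

Lemma glue_l c f g (t : R) : t <= c -> glue c f g t = f t.
Proof. by rewrite /glue => ->. Qed.

Lemma glue_r c f g (t : R) : f c = g 0 -> 0 <= t -> glue c f g (c + t) = g t.
Proof.
move=> fg; rewrite le_eqVlt => /predU1P[<-|t0].
  by rewrite addr0 glue_l.
by rewrite /glue leNgt ltrDl t0 /= addrC addKr.
Qed.

(** Walks rest at the base point outside [0, l], so that all curves live on the whole line and any
    two walks at the same point can be glued. *)
Record closed_walk v (l : R) g : Prop := ClosedWalk {
  walk_ge0 : 0 <= l;
  walk_lipc : lipc g;
  walk_start : forall t : R, t <= 0 -> g t = v;
  walk_end : forall t : R, l <= t -> g t = v }.

Lemma cst_walk v : closed_walk v 0 (fun=> v).
Proof. by split => // s t; exact: dist_refl. Qed.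

Lemma glue_walk v l1 l2 g1 g2 : closed_walk v l1 g1 -> closed_walk v l2 g2 ->
  closed_walk v (l1 + l2) (glue l1 g1 g2).
Proof.
move=> [p1 L1 s1 e1] [p2 L2 s2 e2]; have m : g1 l1 = g2 0 by rewrite e1 ?s2.
split; [exact: addr_ge0|exact: glue_lipc|..] => t ht.
  by rewrite glue_l ?s1 // (le_trans ht).
have [h1 h2] : l2 <= t - l1 /\ 0 <= t - l1 by clear m; split; lra.
have tl : t = l1 + (t - l1) by rewrite addrC subrK.
by rewrite tl (glue_r m h2) e2.
Qed.

Definition excursion d (l : R) g : R -> pt N :=
  glue (len d.1) (dart_pt d) (glue l g (dart_pt (rev_dart d))).

Section Excursion.
Variables (d : dart N) (l : R) (g : R -> pt N).
Hypothesis gw : closed_walk (node_pt (dart_tgt d)) l g.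

Lemma excursion_inner : g l = dart_pt (rev_dart d) 0.
Proof. by rewrite (walk_end gw) // dart_pt0 // dart_src_rev. Qed.

Lemma excursion_outer : dart_pt d (len d.1) = glue l g (dart_pt (rev_dart d)) 0.
Proof. by rewrite glue_l ?(walk_ge0 gw) // (walk_start gw) // dart_pt_len. Qed.

Lemma excursion_walk :
  closed_walk (node_pt (dart_src d)) (2 * len d.1 + l) (excursion d l g).
Proof.
have l0 := walk_ge0 gw; have d0 := len_gt0 d.1; split; first lra.
- apply: glue_lipc excursion_outer; first exact: dart_pt_lipc.
  apply: glue_lipc excursion_inner; last exact: dart_pt_lipc.
  exact: walk_lipc gw.
- by move=> t t0; rewrite /excursion glue_l ?dart_pt0 // (le_trans t0) // ltW.
move=> t tl; rewrite (_ : t = len d.1 + (l + (t - len d.1 - l))); last lra.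
rewrite /excursion (glue_r excursion_outer)
  ?(glue_r excursion_inner) ?dart_pt_len ?dart_tgt_rev //=; lra.
Qed.

Lemma excursion_out (s : R) : s <= len d.1 -> excursion d l g s = dart_pt d s.
Proof. by move=> sl; rewrite /excursion glue_l. Qed.

Lemma excursion_in (t : R) : 0 <= t <= l -> excursion d l g (len d.1 + t) = g t.
Proof. by move=> /andP[t0 tl]; rewrite /excursion (glue_r excursion_outer) // glue_l. Qed.

Lemma excursion_back (s : R) : s <= len d.1 ->
  excursion d l g (2 * len d.1 + l - s) = dart_pt d s.
Proof.
move=> sl; have l0 := walk_ge0 gw.
rewrite (_ : _ - s = len d.1 + (l + (len d.1 - s))); last lra.
rewrite /excursion (glue_r excursion_outer)
  ?(glue_r excursion_inner) ?dart_pt_rev ?subKr //; lra.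
Qed.

End Excursion.

Section Good.
Variables (L alpha : R).

(** Here [L] is the period of the final loop, not the duration [l] of the walk; hence the property
    survives insertion into a longer walk. *)
Definition twice (l : R) g x := exists t t' : R,
  [/\ 0 <= t, t' <= l, g t = x, g t' = x & alpha <= t' - t <= L - alpha].

Hypothesis alpha0 : 0 < alpha.

Lemma twice_embed (l l' c : R) f g x : 0 <= c -> c + l <= l' ->
  (forall t, 0 <= t <= l -> f (c + t) = g t) -> twice l g x -> twice l' f x.
Proof.
have al0 := alpha0.
move=> c0 cl fg [t [t' [t0 tl gt gt' h]]]; exists (c + t), (c + t').
have [h1 h2 h3 h4 h5] : [/\ 0 <= c + t, c + t' <= l', 0 <= t <= l, 0 <= t' <= l
    & alpha <= c + t' - (c + t) <= L - alpha].
  by clear gt gt'; split; lra.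
by split; rewrite // fg.
Qed.

Lemma twice_glue_l v l1 l2 g1 g2 x : closed_walk v l1 g1 -> closed_walk v l2 g2 ->
  twice l1 g1 x -> twice (l1 + l2) (glue l1 g1 g2) x.
Proof.
move=> w1 w2; apply: (@twice_embed _ _ 0) => //.
  by rewrite add0r lerDl (walk_ge0 w2).
by move=> t /andP[t0 tl]; rewrite add0r glue_l.
Qed.

Lemma twice_glue_r v l1 l2 g1 g2 x : closed_walk v l1 g1 -> closed_walk v l2 g2 ->
  twice l2 g2 x -> twice (l1 + l2) (glue l1 g1 g2) x.
Proof.
move=> w1 w2; apply: (@twice_embed _ _ l1) => //; first exact: walk_ge0 w1.
move=> t /andP[t0 tl]; rewrite glue_r //.
by rewrite (walk_end w1) // (walk_start w2).
Qed.

End Good.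
End Walks.

(** * Durations and construction of the tour *)

Section Tour.
Context {R : realType} (N : network R) (alpha : R).
Hypothesis NT : is_tree N.
Hypothesis alpha_gt0 : 0 < alpha.
Hypothesis alpha_lt : alpha < 2 * length [set: pt N].
Hypothesis LC : leaf_condition N alpha.
Implicit Types (d e : dart N) (a b : arc N) (v w : node N) (x y : pt N).

Local Notation E := (@extremity R N alpha).
Local Notation L := (E_period N alpha).
Local Notation long := (long alpha).
Local Notation dbl := (doubled_len alpha).

(* Half the time that the tour spends on [a]. *)
Definition weight a : R := len a + dbl a.

Definition branch_weight d : R := \sum_(b in branch d) weight b.

Definition stub_length v : R := \sum_(e in out v | ~~ long e.1) len e.1.

Lemma doubled_len_ge0 a : 0 <= dbl a.
Proof. by rewrite /doubled_len; case: ifP => // _; rewrite ltW ?tip_len_gt0. Qed.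

Lemma E_periodE : L = 2 * \sum_(a : arc N) weight a.
Proof.
rewrite /E_period /augmented_length lengthT.
by rewrite (length_extremity NT alpha_gt0 LC) big_split.
Qed.

Lemma branch_weight_side d : branch_weight d = weight d.1 + \sum_(b in side d) weight b.
Proof. exact: sum_branch. Qed.

Lemma period_split d : L = 2 * (branch_weight d + \sum_(b in side (rev_dart d)) weight b).
Proof. by rewrite E_periodE (sum_side_rev weight d) branch_weight_side. Qed.

Lemma side_weight_ge d : \sum_(b in side d) len b <= \sum_(b in side d) weight b.
Proof. by apply: ler_sum => b _; rewrite lerDl doubled_len_ge0. Qed.

(* Stubs, i.e. arcs that are not long, are leaf arcs lying entirely within
   alpha / 2 of their leaf. *)
Lemma stub_leaf d : ~~ is_leaf (dart_src d) -> ~~ long d.1 -> is_leaf (dart_tgt d).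
Proof.
rewrite /long negb_imply => nl /andP[/leafyP[e ed le] _].
by case: (dart_eq_or_rev ed) => eE; move: le; rewrite eE // dart_tgt_rev (negbTE nl).
Qed.

(** A stub is a leaf arc of length at most alpha / 2, so all of its length is doubled and nothing
    lies beyond it. *)
Lemma stub_weight d : ~~ is_leaf (dart_src d) -> ~~ long d.1 ->
  branch_weight d = 2 * len d.1.
Proof.
move=> nl nlo; rewrite branch_weight_side (leaf_dart_side NT (stub_leaf nl nlo)) big_set0.
move: nlo; rewrite /long negb_imply -leNgt => /andP[lf la].
by rewrite /weight /doubled_len lf /tip_len min_l //; lra.
Qed.

Lemma stub_length_ge0 v : 0 <= stub_length v.
Proof. by apply: sumr_ge0 => e _; rewrite ltW ?len_gt0. Qed.

Lemma long_weight_ge d : long d.1 -> ~~ is_leaf (dart_src d) ->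
  alpha / 2 <= branch_weight d.
Proof.
move=> lo ns; rewrite branch_weight_side.
have d0 := len_gt0 d.1; have b0 := doubled_len_ge0 d.1.
have s0 := side_weight_ge d.
have [lt|nlt] := boolP (is_leaf (dart_tgt d)).
  have /implyP/(_ _)/= al := lo.
  have lf : leafy d.1 by apply/leafyP; exists d.
  have := al lf; have : 0 <= \sum_(b in side d) weight b.
    by apply: sumr_ge0 => b _; rewrite addr_ge0 ?doubled_len_ge0 // ltW ?len_gt0.
  rewrite /weight; lra.
have := long_side NT alpha_gt0 LC lo nlt; rewrite /weight in s0 *; lra.
Qed.

(* The middle term is the time between two rounds of the stubs at [v] when the
   tour of the long branch [d] is made in between. *)
Lemma stub_separation v d : ~~ is_leaf v -> dart_src d = v -> long d.1 ->
  alpha <= 2 * stub_length v + 2 * branch_weight d <= L - alpha.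
Proof.
move=> nv dv lo; have nd : ~~ is_leaf (dart_src d) by rewrite dv.
have h1 := long_weight_ge lo nd; have h2 := stub_length_ge0 v.
apply/andP; split; first lra.
rewrite (period_split d).
(* The plain lengths behind [d] give alpha / 2 by [long_side]; the stubs at [v] are also behind [d],
   and their doubled lengths give the rest. *)
suff : alpha / 2 + stub_length v <= \sum_(b in side (rev_dart d)) weight b by lra.
have lr : alpha / 2 <= \sum_(b in side (rev_dart d)) len b.
  by apply: (@long_side _ _ _ NT alpha_gt0 LC (rev_dart d)); rewrite ?dart_tgt_rev.
rewrite /weight big_split /=; apply: lerD => //.
rewrite (sum_side NT dbl) dart_tgt_rev rev_dartK dv.
rewrite [leLHS]big_mkcond [leRHS]big_mkcond /=; apply: ler_sum => e _.
case eo: (e \in out v) => //=; have ev : dart_src e = v by apply/eqP; rewrite inE in eo.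
case: ifPn => [nlo|_]; last first.
  by case: ifP => // _; apply: sumr_ge0 => *; exact: doubled_len_ge0.
have -> : e != d by apply: contraNneq nlo => ->.
rewrite (sum_branch dbl) (leaf_dart_side NT) ?big_set0 ?addr0; last first.
  by apply: stub_leaf => //; rewrite ev.
move: nlo; rewrite /long negb_imply -leNgt => /andP[lf la].
by rewrite /doubled_len lf /tip_len min_l.
Qed.

Local Notation good := (twice L alpha).

Definition tours v (l : R) g (F : {set arc N}) :=
  closed_walk (node_pt v) l g /\
  forall b (s : R), b \in F -> 0 <= s <= len b -> good l g (arc_pt b s).

(** A single visit suffices here: the second one comes from repeating the same round in
    [node_walk]. *)
Lemma stub_walk v (es : seq (dart N)) :
  {in es, forall e, dart_src e = v} ->
  exists g, closed_walk (node_pt v) (2 * \sum_(e <- es) len e.1) g /\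
    forall e (s : R), e \in es -> 0 <= s <= len e.1 ->
      exists t, 0 <= t <= 2 * \sum_(e <- es) len e.1 /\ g t = dart_pt e s.
Proof.
elim: es => [_|e es IH ev].
  exists (fun=> node_pt v); rewrite big_nil mulr0; split=> //; exact: cst_walk.
have [|g [gw gv]] := IH; first by move=> e' es'; apply: ev; rewrite inE es' orbT.
have := excursion_walk (cst_walk (node_pt (dart_tgt e))).
rewrite addr0 ev ?mem_head // => ew.
exists (glue (2 * len e.1) (excursion e 0 (fun=> node_pt (dart_tgt e))) g).
have e0 := len_gt0 e.1; have s0 := walk_ge0 gw; rewrite big_cons mulrDr.
split; first exact: glue_walk.
move=> e' s; rewrite inE => /predU1P[->|e'es] hs.
  exists s; split; first lra.
  rewrite glue_l; last lra.
  by rewrite excursion_out //; case/andP: hs.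
have [t [t0 gt]] := gv _ _ e'es hs.
exists (2 * len e.1 + t); split; first by clear gt; lra.
rewrite glue_r //; last by case/andP: t0.
by rewrite (walk_end ew) // (walk_start gw).
Qed.

Lemma long_walk v (es : seq (dart N)) :
  {in es, forall e, exists g, tours v (2 * branch_weight e) g (branch e)} ->
  exists g, closed_walk (node_pt v) (2 * \sum_(e <- es) branch_weight e) g /\
    forall e b (s : R), e \in es -> b \in branch e -> 0 <= s <= len b ->
      good (2 * \sum_(e <- es) branch_weight e) g (arc_pt b s).
Proof.
elim: es => [_|e es IH ev].
  exists (fun=> node_pt v); rewrite big_nil mulr0; split=> //; exact: cst_walk.
have [|g [gw gv]] := IH; first by move=> e' es'; apply: ev; rewrite inE es' orbT.
have [f [fw fv]] := ev e (mem_head _ _).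
exists (glue (2 * branch_weight e) f g); rewrite big_cons mulrDr.
split; first exact: glue_walk.
move=> e' b s; rewrite inE => /predU1P[->|e'es] be hs.
  by apply: twice_glue_l fw gw _ => //; exact: fv.
by apply: twice_glue_r fw gw _ => //; exact: gv be hs.
Qed.

(* Go around the stubs at [v], tour the first long branch, go around the stubs
   again, and tour the other long branches. *)
Lemma node_walk v (es : seq (dart N)) : ~~ is_leaf v ->
  {in es, forall e, [/\ dart_src e = v, long e.1 &
     exists g, tours v (2 * branch_weight e) g (branch e)]} ->
  (es = [::] -> alpha <= 2 * stub_length v <= L - alpha) ->
  exists g,
  let l := 4 * stub_length v + 2 * \sum_(e <- es) branch_weight e in
  closed_walk (node_pt v) l g /\
  forall e b (s : R), e \in es \/ e \in out v /\ ~~ long e.1 -> b \in branch e ->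
    0 <= s <= len b -> good l g (arc_pt b s).
Proof.
move=> nv esv es0; have al0 := alpha_gt0.
pose stubs := enum [set e in out v | ~~ long e.1]%SET.
have stubsv : {in stubs, forall e, dart_src e = v}.
  by move=> e; rewrite mem_enum !inE => /andP[/eqP].
have [g [gw gv]] := stub_walk stubsv.
have gl : \sum_(e <- stubs) len e.1 = stub_length v.
  by rewrite big_enum /=; apply: eq_bigl => e; rewrite !inE.
rewrite gl in gw gv.
have [|f1 [f1w f1v]] := @long_walk v (take 1 es).
  by move=> e /mem_take /esv[].
have [|f2 [f2w f2v]] := @long_walk v (drop 1 es).
  by move=> e /mem_drop /esv[].
set l1 := 2 * \sum_(e <- take 1 es) _ in f1w f1v.
set l2 := 2 * \sum_(e <- drop 1 es) _ in f2w f2v.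
(* The delay between the starts of the two rounds; [take 1 es] is the long branch toured between
   them, if there is one. *)
have sep : alpha <= 2 * stub_length v + l1 <= L - alpha.
  rewrite /l1; case: {f1w f1v f2w f2v l1 l2} es es0 esv => [/(_ erefl) + _|e es _ esv] /=.
    by rewrite big_nil mulr0 addr0.
  have [ev lo _] := esv e (mem_head _ _).
  rewrite take0 big_seq1; exact: stub_separation.
have hw := glue_walk gw (glue_walk f1w (glue_walk gw f2w)).
exists (glue (2 * stub_length v) g (glue l1 f1 (glue (2 * stub_length v) g f2))) => /=.
have lE : 4 * stub_length v + 2 * \sum_(e <- es) branch_weight e =
    2 * stub_length v + (l1 + (2 * stub_length v + l2)).
  rewrite -[in LHS](cat_take_drop 1 es) big_cat /= /l1 /l2; lra.
rewrite lE; split=> // e b s he be hs.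
have [ees|nes] := boolP (e \in es).
  have : e \in take 1 es ++ drop 1 es by rewrite cat_take_drop.
  rewrite mem_cat => /orP[e1|e2].
    apply: (twice_glue_r alpha_gt0 gw (glue_walk f1w (glue_walk gw f2w))).
    apply: (twice_glue_l alpha_gt0 f1w (glue_walk gw f2w)).
    exact: f1v e1 be hs.
  apply: (twice_glue_r alpha_gt0 gw (glue_walk f1w (glue_walk gw f2w))).
  apply: (twice_glue_r alpha_gt0 f1w (glue_walk gw f2w)).
  apply: (twice_glue_r alpha_gt0 gw f2w).
  exact: f2v e2 be hs.
case: he => [/negPn|[eo nlo]]; first by rewrite negbK (negbTE nes).
have ev : dart_src e = v by apply/eqP; rewrite inE in eo.
have le : is_leaf (dart_tgt e) by apply: stub_leaf => //; rewrite ev.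
have bE : b = e.1.
  by move: be; rewrite !inE -in_side (leaf_dart_side NT le) finset.in_set0 orbF => /eqP.
rewrite bE in hs *; have [s' hs' <-] := dart_pt_arc hs.
have est : e \in stubs by rewrite mem_enum !inE ev eqxx.
have [t [t0 gt]] := gv _ _ est hs'.
have [q0 q1 q2] := And3 (walk_ge0 gw) (walk_ge0 f1w) (walk_ge0 f2w).
(* The same offset in both rounds, so the delay is exactly the quantity bounded in [sep]. *)
exists t, (2 * stub_length v + (l1 + t)); split.
- by case/andP: t0.
- by clear gt; lra.
- by rewrite glue_l //; case/andP: t0.
- rewrite glue_r; last by clear gt; lra.
    rewrite glue_r; last by case/andP: t0.
      by rewrite glue_l //; case/andP: t0.
    by rewrite (walk_end f1w) // glue_l // (walk_start gw).
  by rewrite (walk_end gw) // glue_l // (walk_start f1w).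
- clear gt; lra.
Qed.

(* A swing of length alpha / 2 out of a long leaf arc and back, so that its
   extremity is traversed four times. *)
Lemma leaf_swing d : is_leaf (dart_tgt d) -> alpha / 2 < len d.1 ->
  exists g, closed_walk (node_pt (dart_tgt d)) alpha g /\
    forall r : R, 0 <= r <= alpha / 2 ->
      g (alpha - r) = dart_pt d (len d.1 - r).
Proof.
move=> ld al; have al0 := alpha_gt0.
pose f (t : R) := dart_pt d (len d.1 - alpha / 2 + t).
have m : dart_pt (rev_dart d) (alpha / 2) = f 0 by rewrite dart_pt_rev /f addr0.
have fL : lipc f.
  move=> s t; apply: (le_trans (@dart_pt_lipc _ _ _ _ _)); rewrite lee_fin.
  by rewrite opprD addrACA subrr add0r.
exists (glue (alpha / 2) (dart_pt (rev_dart d)) f); split.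
  split; first exact: ltW.
  - by apply: glue_lipc m => //; exact: dart_pt_lipc.
  - move=> t t0; rewrite glue_l; first by rewrite dart_pt0 // dart_src_rev.
    clear m; lra.
  move=> t ta; rewrite (_ : t = alpha / 2 + (t - alpha / 2)); last by rewrite addrC subrK.
  have [h1 h2] : 0 <= t - alpha / 2 /\ len d.1 <= len d.1 - alpha / 2 + (t - alpha / 2).
    by clear m; split; lra.
  by rewrite (glue_r m h1) /f dart_pt_len.
move=> r hr; have [h1 h2 h3] : [/\ 0 <= alpha / 2 - r, 
    alpha - r = alpha / 2 + (alpha / 2 - r)
    & len d.1 - alpha / 2 + (alpha / 2 - r) = len d.1 - r] by clear m; split; lra.
by rewrite h2 (glue_r m h1) /f h3.
Qed.

(** A point within alpha / 2 of the leaf is met on the way out and again at the end of the swing;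
    any other point of the arc is met on the way out and on the way back. *)
Lemma leaf_branch_tour d : long d.1 -> is_leaf (dart_tgt d) ->
  exists g, tours (dart_src d) (2 * branch_weight d) g (branch d).
Proof.
move=> lo ld; have al0 := alpha_gt0; have d0 := len_gt0 d.1.
have lf : leafy d.1 by apply/leafyP; exists d.
have al : alpha / 2 < len d.1 by move: lo; rewrite /long lf.
have [g [gw gv]] := leaf_swing ld al.
have wE : 2 * branch_weight d = 2 * len d.1 + alpha.
  rewrite branch_weight_side (leaf_dart_side NT ld) big_set0 /weight /doubled_len lf.
  by rewrite /tip_len min_r ?ltW //; lra.
have LE := period_split d.
have sr : alpha / 2 <= \sum_(b in side (rev_dart d)) weight b.
  apply: le_trans (side_weight_ge _).
  apply: (@long_side _ _ _ NT alpha_gt0 LC (rev_dart d)) => //.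
  by rewrite dart_tgt_rev leaf_src_not_leaf.
rewrite wE; exists (excursion d alpha g); split; first exact: excursion_walk.
move=> b s; rewrite in_branch => bd; have {bd} -> : b = d.1.
  apply/eqP; move: bd; case: eqP => // /eqP bd /= h.
  have : b \in side d by rewrite inE bd h.
  by rewrite (leaf_dart_side NT ld) finset.in_set0.
move=> hs; have [s' hs' <-] := dart_pt_arc hs.
have [s'1 s'2] := andP hs'.
have [rs|rs] := leP (len d.1 - s') (alpha / 2).
  (* The second time is exactly alpha after the first. *)
  exists s', (len d.1 + (alpha - (len d.1 - s'))); split.
  - exact: s'1.
  - clear gv gw; lra.
  - by rewrite excursion_out.
  - rewrite excursion_in //; last by clear gv gw; lra.
    by rewrite gv ?subKr //; clear gv gw; lra.
  - clear gv gw; lra.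
exists s', (2 * len d.1 + alpha - s'); split.
- exact: s'1.
- clear gv gw; lra.
- by rewrite excursion_out.
- by rewrite (excursion_back gw).
- clear gv gw; lra.
Qed.

Lemma big_stubs_longs v (es : seq (dart N)) (P : pred (dart N)) : ~~ is_leaf v ->
  es = enum [set e in out v | long e.1 & P e]%SET ->
  {in out v, forall e, ~~ long e.1 -> P e} ->
  \sum_(e in out v | P e) branch_weight e =
  2 * stub_length v + \sum_(e <- es) branch_weight e.
Proof.
move=> nv -> H; rewrite (bigID (fun e => long e.1)) /= addrC; congr (_ + _).
  rewrite /stub_length mulr_sumr; apply: eq_big => e.
    case eo: (e \in out v) => //=; case lo: (long e.1); rewrite ?andbF //=.
    by rewrite H // lo.
  move=> /andP[/andP[eo _] lo]; apply: stub_weight => //.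
  by move: eo; rewrite inE => /eqP ->.
by rewrite big_enum /=; apply: eq_bigl => e; rewrite !inE -andbA [P e && _]andbC.
Qed.

(** Unless the target is a leaf, the tour goes along [d], makes the node walk at its target, and
    returns. For a point of [d] the time between its visits is at least twice the weight ahead, and
    the rest of the period at least twice the weight behind; [long_side], applied to [d] and to its
    reverse, bounds both by alpha. *)
Lemma branch_tour d : long d.1 -> ~~ is_leaf (dart_src d) ->
  exists g, tours (dart_src d) (2 * branch_weight d) g (branch d).
Proof.
have [n] := ubnP #|side d|; elim: n d => // n IH d dn lo ns.
have [ld|nl] := boolP (is_leaf (dart_tgt d)); first exact: leaf_branch_tour.
set v := dart_tgt d in nl *.
have al0 := alpha_gt0; have d0 := len_gt0 d.1.
pose es := enum [set e in out v | long e.1 & e != rev_dart d]%SET.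
have esP e : (e \in es) = [&& dart_src e == v, long e.1 & e != rev_dart d].
  by rewrite mem_enum !inE.
have esv : {in es, forall e, [/\ dart_src e = v, long e.1 &
     exists g, tours v (2 * branch_weight e) g (branch e)]}.
  move=> e; rewrite esP => /and3P[/eqP ev el er]; split=> //.
  rewrite -ev; apply: IH => //; last by rewrite ev.
  by exact: (leq_trans (card_side_lt NT ev er) dn).
have sideE : \sum_(b in side d) weight b =
    2 * stub_length v + \sum_(e <- es) branch_weight e.
  rewrite (sum_side NT) -/v; apply: big_stubs_longs => // e eo nlo.
  by apply: contraNneq nlo => ->.
have LE := period_split d.
have s1 : alpha / 2 <= \sum_(b in side d) len b := long_side NT alpha_gt0 LC lo nl.
have s2 : alpha / 2 <= \sum_(b in side (rev_dart d)) weight b.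
  apply: le_trans (side_weight_ge _).
  by apply: (@long_side _ _ _ NT alpha_gt0 LC (rev_dart d)); rewrite // dart_tgt_rev.
have s3 := side_weight_ge d.
have wE : branch_weight d = len d.1 + \sum_(b in side d) weight b.
  (* Neither end of the arc is a leaf, so none of it is doubled. *)
  rewrite branch_weight_side /weight /doubled_len ifF ?addr0 //; apply/negP.
  case/leafyP => e ed le; case: (dart_eq_or_rev ed) => eE; move: le; rewrite eE.
    by rewrite (negbTE nl).
  by rewrite dart_tgt_rev (negbTE ns).
(* Only stubs lie beyond [d], so [stub_length v] is the whole length ahead of [d], which [long_side]
   bounds from below. *)
have es0 : es = [::] -> alpha <= 2 * stub_length v <= L - alpha.
  move=> esE; move: sideE; rewrite esE big_nil addr0 => sE.
  have lenE : \sum_(b in side d) len b = stub_length v.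
    rewrite (sum_side NT (@len R N)) -/v /stub_length; apply: eq_big => e.
      case eo: (e \in out v) => //=; rewrite inE in eo.
      have := esP e; rewrite esE in_nil eo /=.
      have [el /= <-//|nel _] := boolP (long e.1).
      by apply: contraNneq nel => ->.
    move=> /andP[eo er].
    rewrite (sum_branch (@len R N)) (leaf_dart_side NT) ?big_set0 ?addr0 //.
    move: eo; rewrite inE => ev; apply: stub_leaf; first by rewrite (eqP ev).
    by have := esP e; rewrite esE in_nil ev er andbT /= => <-.
  rewrite lenE in s1; lra.
have [g [gw gv]] := node_walk nl esv es0.
set l := (X in closed_walk _ X _) in gw gv.
have lE : 2 * branch_weight d = 2 * len d.1 + l.
  rewrite wE sideE /l; lra.
have lE2 : l = 2 * \sum_(b in side d) weight b by rewrite sideE /l; lra.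
rewrite lE; exists (excursion d l g); split; first exact: excursion_walk.
move=> b s bd hs; have [bE|bE] := eqVneq b d.1.
  rewrite bE in hs *; have [s' hs' <-] := dart_pt_arc hs.
  have [s'1 s'2] := andP hs'.
  exists s', (2 * len d.1 + l - s'); split.
  - exact: s'1.
  - clear gv gw; lra.
  - by rewrite excursion_out.
  - by rewrite (excursion_back gw).
  - clear gv gw; lra.
have [e ev be] := branch_cover NT v b.
have er : e != rev_dart d.
  apply/eqP => eE; move: be; rewrite eE branchC rev_dartK finset.in_setC.
  by move: bd; rewrite in_branch (negbTE bE) /= => ab; rewrite inE bE ab.
have eev : e \in es \/ e \in out v /\ ~~ long e.1.
  rewrite esP inE ev eqxx er andbT /=.
  by have [?|?] := boolP (long e.1); [left|right].
apply: (@twice_embed _ _ _ _ alpha_gt0 l _ (len d.1) _ g).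
- exact: ltW.
- by clear gv gw; lra.
- by move=> t tl; rewrite excursion_in.
- exact: gv eev be hs.
Qed.

Lemma covering_loop_exists (a0 : arc N) : exists S : R -> pt N, covering_loop alpha S.
Proof.
have [v nv] := nonleaf_exists NT a0; have al0 := alpha_gt0.
pose es := enum [set e in out v | long e.1 & true]%SET.
have esP e : (e \in es) = (dart_src e == v) && long e.1.
  by rewrite mem_enum !inE andbT.
have esv : {in es, forall e, [/\ dart_src e = v, long e.1 &
     exists g, tours v (2 * branch_weight e) g (branch e)]}.
  move=> e; rewrite esP => /andP[/eqP ev el]; split=> //.
  by rewrite -ev; apply: branch_tour; rewrite ?ev.
have LE : L = 4 * stub_length v + 2 * \sum_(e <- es) branch_weight e.
  rewrite E_periodE (sum_out NT weight v).
  have := @big_stubs_longs v es xpredT nv erefl (fun _ _ _ => isT).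
  under eq_bigl do rewrite andbT; move=> H.
  have -> : \sum_(d in out v) \sum_(b in branch d) weight b =
    2 * stub_length v + \sum_(e <- es) branch_weight e := H.
  lra.
(* The tree is then a star of stubs with L equal to four times its length, and both inequalities
   amount to alpha <= 2 mu. *)
have es0 : es = [::] -> alpha <= 2 * stub_length v <= L - alpha.
  move=> esE; move: LE; rewrite esE big_nil mulr0 addr0 => LE.
  have lenE : length [set: pt N] = stub_length v.
    rewrite lengthT (sum_out NT _ v) /stub_length; apply: eq_big => e.
      case eo: (e \in out v) => //=; rewrite inE in eo.
      by have := esP e; rewrite esE in_nil eo /= => <-.
    rewrite inE => ev.
    rewrite (sum_branch (@len R N)) (leaf_dart_side NT) ?big_set0 ?addr0 //.
    apply: stub_leaf; first by rewrite (eqP ev).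
    by have := esP e; rewrite esE in_nil ev /= => <-.
  have := alpha_lt; rewrite lenE; lra.
have [g [gw gv]] := node_walk nv esv es0.
rewrite -LE in gw gv; have L0 := walk_ge0 gw.
exists g; split.
- by rewrite (walk_start gw) // (walk_end gw).
- move=> s t s0 st tL; apply: (le_trans (walk_lipc gw _ _)).
  by rewrite distrC ger0_norm ?subr_ge0.
move=> x; have [b [s [hs ->]]] := pt_on_arc NT a0 x.
have [e ev be] := branch_cover NT v b.
have eev : e \in es \/ e \in out v /\ ~~ long e.1.
  rewrite esP inE ev eqxx /=.
  by have [?|?] := boolP (long e.1); [left|right].
have [t [t' [t0 tL gt gt' h]]] := gv e b s eev be hs.
have [h1 h2] := andP h.
(* Visits must be timed in [0, L[, so a visit at time L is moved to time 0. *)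
move: tL; rewrite le_eqVlt => /predU1P[tE|tL].
  exists t, 0; split => //.
  - by clear gt gt'; lra.
  - by clear gt gt'; lra.
  - by rewrite -gt' tE (walk_start gw) // (walk_end gw).
  by rewrite /cyclic_dist subr0 ger0_norm // le_min; clear gt gt'; lra.
exists t, t'; split => //.
- by clear gt gt'; lra.
- by clear gt gt'; lra.
rewrite /cyclic_dist distrC ger0_norm; last by clear gt gt'; lra.
by rewrite le_min; clear gt gt'; lra.
Qed.

End Tour.

(** * Weak duality between the guarantees *)

Section Duality.
Context {R : realType} (N : network R) (alpha : R).
Local Open Scope ereal_scope.

Lemma lower_le_upper_value : lower_value N alpha <= upper_value N alpha.
Proof.
apply: ge_ereal_sup => _ [p _ <-]; apply: le_ereal_inf_tmp => _ [a _ <-].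
apply: (@le_trans _ _ (payoff alpha p a)).
  by apply: ereal_inf_lbound; exists a.
by apply: ereal_sup_ubound; exists p.
Qed.

Lemma guarantee_le_lower_value (p : mixed_patrol N) :
  patroller_guarantee alpha p <= lower_value N alpha.
Proof. by apply: ereal_sup_ubound; exists p. Qed.

Lemma upper_value_le_guarantee (a : mixed_attack N) :
  upper_value N alpha <= attacker_guarantee alpha a.
Proof. by apply: ereal_inf_lbound; exists a. Qed.

End Duality.

Theorem theorem8 (R : realType) (Q : network R) (alpha : R)
    (Qtree : is_tree Q) (alpha_gt0 : 0 < alpha)
    (alpha_lt : alpha < 2 * length [set: pt Q])
    (QLC : leaf_condition Q alpha) :
  [/\ forall S : R -> pt Q, is_E_path alpha S ->
        (exists p, is_E_patrolling alpha S p) /\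
        (forall p, is_E_patrolling alpha S p -> patroller_optimal alpha p),
      (exists a : mixed_attack Q, is_E_attack alpha a) /\
      (forall a : mixed_attack Q,
         is_E_attack alpha a -> attacker_optimal alpha a)
    & game_value Q alpha
        (alpha / (length [set: pt Q] + length (extremity alpha : set (pt Q))))%:E].
Proof.
have W0 : 0 < augmented_length Q alpha.
  apply: ltr_pwDl; last exact: length_ge0.
  by have := lt_trans alpha_gt0 alpha_lt; rewrite pmulr_rgt0.
(* The total length is positive, so there is an arc; it allows every node to be placed on some
   arc. *)
have [b _] : exists b : arc Q, True.
  apply: contrapT => H; move: (lt_trans alpha_gt0 alpha_lt).
  rewrite lengthT big1 ?mulr0 ?ltxx // => b _.
  by exfalso; apply: H; exists b.
have attack (a : mixed_attack Q) : is_E_attack alpha a -> (attacker_guarantee alpha a <=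
    (alpha / augmented_length Q alpha)%:E)%E.
  by move=> aE; apply: (E_attack_guarantee Qtree alpha_gt0 QLC b W0 aE).
have patrolling (S : R -> pt Q) (p : mixed_patrol Q) : 
    covering_loop alpha S -> is_E_patrolling alpha S p ->
    ((alpha / augmented_length Q alpha)%:E <= patroller_guarantee alpha p)%E.
  by move=> SL; exact: (E_patrolling_guarantee Qtree alpha_gt0 W0 SL b).
(* The constructed tour supplies the lower bound on the value; a given E-path is afterwards compared
   with the value so obtained. *)
have [S0 S0L] := covering_loop_exists Qtree alpha_gt0 alpha_lt QLC b.
have [p0 p0E] := E_patrolling_exists W0 S0L.
have [a0 a0E] := E_attack_exists Qtree alpha_gt0 QLC W0.
have lower_ge := le_trans (patrolling _ _ S0L p0E) (guarantee_le_lower_value alpha p0).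
have upper_le := le_trans (upper_value_le_guarantee alpha a0) (attack _ a0E).
have lowerE : lower_value Q alpha = (alpha / augmented_length Q alpha)%:E.
  apply/eqP; rewrite eq_le lower_ge andbT.
  exact: le_trans (lower_le_upper_value Q alpha) upper_le.
have upperE : upper_value Q alpha = (alpha / augmented_length Q alpha)%:E.
  apply/eqP; rewrite eq_le upper_le /=.
  exact: le_trans lower_ge (lower_le_upper_value Q alpha).
split; last by split.
- move=> S /E_path_covering_loop SL; split; first exact: E_patrolling_exists.
  move=> p pE; apply/eqP; rewrite eq_le guarantee_le_lower_value lowerE /=.
  exact: patrolling pE.
- split; first by exists a0.
  move=> a aE; apply/eqP; rewrite eq_le upper_value_le_guarantee andbT upperE.
  exact: attack.
Qed.
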